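(* Let $S$ be a finite dimensional semisimple $\mathbb{C}$-algebra and let $M$ be a (finite dimensional) $S$-bimodule. Then every dualizing structure on $(S,M)$ is isomorphic to the dualizing structure $(S_\gamma,\mathrm{Rep}(\mathbb{Q},\gamma))$ coming from some supermixed quiver setting $(\mathbb{Q},\gamma)$.
   Context: Everything is over $\mathbb{C}$. A dualizing structure on $(S,M)$ consists of two linear involutions $*:S\to S$ and $*:M\to M$ such that $(ab)^*=b^*a^*$ and $(amb)^*=b^*m^*a^*$ for all $a,b\in S$, $m\in M$. Two dualizing structures $(S,M)$ and $(S',M')$ are isomorphic if there are an algebra isomorphism $f:S\to S'$ and a linear isomorphism $F:M\to M'$ with $F(amb)=f(a)F(m)f(b)$, both commuting with the involutions. A quiver $Q$ has finite vertex set $Q_0$, finite arrow set $Q_1$, and head and tail maps $h,t:Q_1\to Q_0$. A supermixed quiver $\mathbb{Q}=(Q,\phi,\epsilon,\sigma)$ consists of a quiver $Q$, two involutions both denoted $\phi$ (one on $Q_0$, one on $Q_1$) and sign maps $\epsilon:Q_0\to\{\pm1\}$, $\sigma:Q_1\to\{\pm1\}$ such that: (M1) $h(\phi(a))=\phi(t(a))$; (M2) $h(a)=h(\phi(a))\Rightarrow a=\phi(a)$; (M3) $\epsilon_v\epsilon_{\phi(v)}=1=\sigma_a\sigma_{\phi(a)}$. A supermixed quiver setting $(\mathbb{Q},\gamma)$ is a supermixed quiver together with an assignment of an invertible complex square matrix $\gamma_v$ to each vertex $v$ such that $\gamma_v=\epsilon_v\gamma_{\phi(v)}^{\top}$. Let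 $\bar\gamma_v$ denote the size of $\gamma_v$. Put $S_\gamma=\bigoplus_{v\in Q_0}\mathrm{Mat}_{\bar\gamma_v\times\bar\gamma_v}(\mathbb{C})$ and $\mathrm{Rep}(\mathbb{Q},\gamma)=\bigoplus_{a\in Q_1}\mathrm{Mat}_{\bar\gamma_{h(a)}\times\bar\gamma_{t(a)}}(\mathbb{C})$, an $S_\gamma$-bimodule via $(smr)_a=s_{h(a)}m_ar_{t(a)}$. The dualizing structure coming from $(\mathbb{Q},\gamma)$ is given by $$(s^* )_v=\gamma_{\phi(v)}^{-1}s_{\phi(v)}^{\top}\gamma_{\phi(v)},\qquad (m^* )_a=\sigma_a\epsilon_{t(a)}\,\gamma_{\phi(h(a))}^{-1}m_{\phi(a)}^{\top}\gamma_{\phi(t(a))}.$$ *)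

(* Defs.v *)
From HB Require Import structures.
From mathcomp Require Import all_boot all_order all_algebra.
From mathcomp Require Export complex reals.

Set Implicit Arguments.
Unset Strict Implicit.
Unset Printing Implicit Defensive.

Import GRing.Theory.
Local Open Scope ring_scope.

(* Unital associative algebras over K, the zero algebra included.  The library's
   [algType] demands 1 != 0, which fails for an empty sum of matrix algebras, and
   the hierarchy has no room for a weaker join of [pzRingType] and [lmodType];
   hence the scaling is a field here and the module structure is derived. *)
HB.mixin Record PzRing_isPzAlgebra (K : pzRingType) A of GRing.PzRing A := {
  algscale : K -> A -> A;
  algscaleA : forall k l x, algscale k (algscale l x) = algscale (k * l) x;
  algscale1 : forall x, algscale 1 x = x;
  algscaleDr : forall k x y, algscale k (x + y) = algscale k x + algscale k y;
  algscaleDl : forall x k l, algscale (k + l) x = algscale k x + algscale l x;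
  algscaleAl : forall k x y, algscale k (x * y) = algscale k x * y;
  algscaleAr : forall k x y, algscale k (x * y) = x * algscale k y
}.
#[short(type="pzAlgType")]
HB.structure Definition PzAlgebra (K : pzRingType) :=
  {A of GRing.PzRing A & PzRing_isPzAlgebra K A}.

HB.instance Definition _ (K : pzRingType) (A : pzAlgType K) :=
  GRing.Zmodule_isLmodule.Build K A
    algscaleA algscale1 algscaleDr algscaleDl.

(* The base field acts centrally on a bimodule: k *: m = (k *: 1) m = m (k *: 1)
   follows from the linearity of both actions in S. *)
HB.mixin Record Lmodule_isBimodule (K : pzRingType) (S : pzAlgType K) M
    of GRing.Lmodule K M := {
  lact : S -> M -> M;
  ract : M -> S -> M;
  lact_linearl : forall m, linear (fun a => lact a m);
  lact_linearr : forall a, linear (lact a);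
  ract_linearl : forall a, linear (fun m => ract m a);
  ract_linearr : forall m, linear (ract m);
  lact1 : forall m, lact 1 m = m;
  ract1 : forall m, ract m 1 = m;
  lactA : forall a b m, lact (a * b) m = lact a (lact b m);
  ractA : forall m a b, ract m (a * b) = ract (ract m a) b;
  lractA : forall a m b, ract (lact a m) b = lact a (ract m b)
}.
#[short(type="bimodType")]
HB.structure Definition Bimodule (K : pzRingType) (S : pzAlgType K) :=
  {M of GRing.Lmodule K M & Lmodule_isBimodule K S M}.

Definition finite_dimensional (K : fieldType) (V : lmodType K) : Prop :=
  exists n : nat, inhabited (Vector.axiom n V).

Definition left_ideal (S : pzRingType) (I : S -> Prop) : Prop :=
  [/\ I 0, forall x y, I x -> I y -> I (x + y) & forall a x, I x -> I (a * x)].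

(* The left regular module is semisimple: every submodule is a direct summand. *)
Definition semisimple (S : pzRingType) : Prop :=
  forall I : S -> Prop, left_ideal I ->
  exists J : S -> Prop,
    [/\ left_ideal J,
        forall x, I x -> J x -> x = 0
      & forall x, exists y z, [/\ I y, J z & x = y + z]].

Record dualizing (K : pzRingType) (S : pzAlgType K) (M : bimodType S) :=
  Dualizing {
    starS : S -> S;
    starM : M -> M;
    starS_linear : linear starS;
    starM_linear : linear starM;
    starSK : involutive starS;
    starMK : involutive starM;
    starS_mul : forall a b, starS (a * b) = starS b * starS a;
    starM_act : forall a m b,
      starM (ract (lact a m) b) = ract (lact (starS b) (starM m)) (starS a)
  }.

Definition dualizing_iso (K : pzRingType) (S S' : pzAlgType K)
    (M : bimodType S) (M' : bimodType S')
    (D : dualizing M) (D' : dualizing M') : Prop :=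
  exists (f : S -> S') (F : M -> M'),
    [/\ [/\ linear f, monoid_morphism f & bijective f],
        linear F /\ bijective F,
        forall a m b, F (ract (lact a m) b) = ract (lact (f a) (F m)) (f b),
        forall a, f (starS D a) = starS D' (f a)
      & forall m, F (starM D m) = starM D' (F m)].

Record quiver := Quiver {
  vertex : finType;
  arrow : finType;
  head : arrow -> vertex;
  tail : arrow -> vertex
}.

Record supermixed_quiver := SupermixedQuiver {
  smq_quiver :> quiver;
  phi0 : vertex smq_quiver -> vertex smq_quiver;
  phi1 : arrow smq_quiver -> arrow smq_quiver;
  eps : vertex smq_quiver -> int;
  sig : arrow smq_quiver -> int;
  phi0K : involutive phi0;
  phi1K : involutive phi1;
  eps_sign : forall v, eps v = 1 \/ eps v = -1;
  sig_sign : forall a, sig a = 1 \/ sig a = -1;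
  head_phi : forall a, head (phi1 a) = phi0 (tail a);
  head_phi_fix : forall a, head a = head (phi1 a) -> a = phi1 a;
  eps_phi : forall v, eps v * eps (phi0 v) = 1;
  sig_phi : forall a, sig a * sig (phi1 a) = 1
}.

Lemma tail_phi (Q : supermixed_quiver) (a : arrow Q) :
  tail (phi1 a) = phi0 (head a).
Proof. by rewrite -{2}(phi1K a) head_phi phi0K. Qed.

(* [dim_phi] is what makes the equation [gamma_phi] between matrices of a priori
   different sizes meaningful; [castmx] only transports along it. *)
Record setting (K : fieldType) := Setting {
  setting_quiver :> supermixed_quiver;
  dim : vertex setting_quiver -> nat;
  gamma : forall v, 'M[K]_(dim v);
  gamma_unit : forall v, gamma v \in unitmx;
  dim_phi : forall v, dim (phi0 v) = dim v;
  gamma_phi : forall v, gamma v =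
    (eps v)%:~R *: (castmx (dim_phi v, dim_phi v) (gamma (phi0 v)))^T
}.

Section MatrixFamilies.
Variables (K : comNzRingType) (I : finType).

Definition mxfam (p q : I -> nat) := {dffun forall i, 'M[K]_(p i, q i)}.

Section Module.
Variables p q : I -> nat.
Implicit Types s t : mxfam p q.

HB.instance Definition _ := Choice.on (mxfam p q).

Definition mxfam_mk (g : forall i, 'M[K]_(p i, q i)) : mxfam p q := finfun g.

Lemma mxfamE g i : mxfam_mk g i = g i. Proof. exact: ffunE. Qed.
Lemma mxfamP s t : (forall i, s i = t i) <-> s = t.
Proof. exact: ffunP. Qed.

Definition mxfam_add s t := mxfam_mk (fun i => s i + t i).
Definition mxfam_opp s := mxfam_mk (fun i => - s i).
Definition mxfam_scale k s := mxfam_mk (fun i => k *: s i).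

Fact mxfam_addA : associative mxfam_add.
Proof. by move=> r s t; apply/mxfamP=> i; rewrite !mxfamE addrA. Qed.
Fact mxfam_addC : commutative mxfam_add.
Proof. by move=> s t; apply/mxfamP=> i; rewrite !mxfamE addrC. Qed.
Fact mxfam_add0 : left_id (mxfam_mk (fun=> 0)) mxfam_add.
Proof. by move=> s; apply/mxfamP=> i; rewrite !mxfamE add0r. Qed.
Fact mxfam_addN : left_inverse (mxfam_mk (fun=> 0)) mxfam_opp mxfam_add.
Proof. by move=> s; apply/mxfamP=> i; rewrite !mxfamE addNr. Qed.
HB.instance Definition _ := GRing.isZmodule.Build (mxfam p q)
  mxfam_addA mxfam_addC mxfam_add0 mxfam_addN.

Fact mxfam_scaleA k l s :
  mxfam_scale k (mxfam_scale l s) = mxfam_scale (k * l) s.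
Proof. by apply/mxfamP=> i; rewrite !mxfamE scalerA. Qed.
Fact mxfam_scale1 : left_id 1 mxfam_scale.
Proof. by move=> s; apply/mxfamP=> i; rewrite !mxfamE scale1r. Qed.
Fact mxfam_scaleDr : right_distributive mxfam_scale +%R.
Proof. by move=> k s t; apply/mxfamP=> i; rewrite !mxfamE scalerDr. Qed.
Fact mxfam_scaleDl s : {morph mxfam_scale^~ s : k l / k + l}.
Proof. by move=> k l; apply/mxfamP=> i; rewrite !mxfamE scalerDl. Qed.
HB.instance Definition _ := GRing.Zmodule_isLmodule.Build K (mxfam p q)
  mxfam_scaleA mxfam_scale1 mxfam_scaleDr mxfam_scaleDl.

Lemma mxfamD s t i : (s + t) i = s i + t i. Proof. exact: mxfamE. Qed.
Lemma mxfamZ k s i : (k *: s) i = k *: s i. Proof. exact: mxfamE. Qed.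
End Module.

Variable n : I -> nat.
Definition mxalg := mxfam n n.
Implicit Types s t : mxalg.

HB.instance Definition _ := GRing.Zmodule.on mxalg.

Definition mxalg_one : mxalg := mxfam_mk (fun i => 1%:M).
Definition mxalg_scale (k : K) s : mxalg := mxfam_scale k s.
Definition mxalg_mul s t : mxalg := mxfam_mk (fun i => s i *m t i).

Fact mxalg_mulA : associative mxalg_mul.
Proof. by move=> r s t; apply/mxfamP=> i; rewrite !mxfamE mulmxA. Qed.
Fact mxalg_mul1l : left_id mxalg_one mxalg_mul.
Proof. by move=> s; apply/mxfamP=> i; rewrite !mxfamE mul1mx. Qed.
Fact mxalg_mul1r : right_id mxalg_one mxalg_mul.
Proof. by move=> s; apply/mxfamP=> i; rewrite !mxfamE mulmx1. Qed.
Fact mxalg_mulDl : left_distributive mxalg_mul +%R.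
Proof. by move=> r s t; apply/mxfamP=> i; rewrite !mxfamE mulmxDl. Qed.
Fact mxalg_mulDr : right_distributive mxalg_mul +%R.
Proof. by move=> r s t; apply/mxfamP=> i; rewrite !mxfamE mulmxDr. Qed.
HB.instance Definition _ := GRing.Zmodule_isPzRing.Build mxalg
  mxalg_mulA mxalg_mul1l mxalg_mul1r mxalg_mulDl mxalg_mulDr.

Lemma mxalgM s t i : (s * t) i = s i *m t i. Proof. exact: mxfamE. Qed.
Lemma mxalg1 i : (1 : mxalg) i = 1%:M. Proof. exact: mxfamE. Qed.

Fact mxalg_scaleAl k s t : mxalg_scale k (s * t) = mxalg_scale k s * t.
Proof. by apply/mxfamP=> i; rewrite !(mxfamE, mxalgM) scalemxAl. Qed.
Fact mxalg_scaleAr k s t : mxalg_scale k (s * t) = s * mxalg_scale k t.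
Proof. by apply/mxfamP=> i; rewrite !(mxfamE, mxalgM) scalemxAr. Qed.
HB.instance Definition _ := PzRing_isPzAlgebra.Build K mxalg
  (@mxfam_scaleA n n) (@mxfam_scale1 n n) (@mxfam_scaleDr n n)
  (@mxfam_scaleDl n n) mxalg_scaleAl mxalg_scaleAr.
End MatrixFamilies.

Section CastFacts.
Variable K : comUnitRingType.

Lemma castmx_linear m n m' n' (e : (m = m') * (n = n')) :
  linear (@castmx K m n m' n' e).
Proof. by case: e => em en; case: m' / em; case: n' / en. Qed.

Lemma castmxZ m n m' n' (e : (m = m') * (n = n')) k (A : 'M[K]_(m, n)) :
  castmx e (k *: A) = k *: castmx e A.
Proof. by case: e => em en; case: m' / em; case: n' / en. Qed.

Lemma castmx_mulmx m n p m' n' p' (em : m = m') (en : n = n') (ep : p = p')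
    (A : 'M[K]_(m, n)) (B : 'M[K]_(n, p)) :
  castmx (em, ep) (A *m B) = castmx (em, en) A *m castmx (en, ep) B.
Proof. by case: m' / em; case: n' / en; case: p' / ep. Qed.

Lemma castmx_invmx n n' (e : n = n') (A : 'M[K]_n) :
  castmx (e, e) (invmx A) = invmx (castmx (e, e) A).
Proof. by case: n' / e. Qed.

Lemma castmx_fam (T : Type) (p q : T -> nat) (f : forall x, 'M[K]_(p x, q x))
    (x y : T) (e : (p x = p y) * (q x = q y)) :
  x = y -> castmx e (f x) = f y.
Proof. by move=> exy; case: y / exy e => e; rewrite castmx_id. Qed.
End CastFacts.

Section SettingDual.
Variables (K : fieldType) (G : setting K).

Definition salg := mxalg K (@dim K G).
HB.instance Definition _ := PzAlgebra.on salg.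

Definition rep :=
  mxfam K (fun a : arrow G => dim (head a)) (fun a : arrow G => dim (tail a)).
HB.instance Definition _ := GRing.Lmodule.on rep.

Definition rep_lact (s : salg) (m : rep) : rep :=
  mxfam_mk (fun a => s (head a) *m m a).
Definition rep_ract (m : rep) (s : salg) : rep :=
  mxfam_mk (fun a => m a *m s (tail a)).

Fact rep_lact_linearl m : linear (fun s => rep_lact s m).
Proof.
move=> k s t; apply/mxfamP=> a.
by rewrite !(mxfamD, mxfamZ, mxfamE) mulmxDl scalemxAl.
Qed.
Fact rep_lact_linearr s : linear (rep_lact s).
Proof.
move=> k m l; apply/mxfamP=> a.
by rewrite !(mxfamD, mxfamZ, mxfamE) mulmxDr scalemxAr.
Qed.
Fact rep_ract_linearl s : linear (fun m => rep_ract m s).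
Proof.
move=> k m l; apply/mxfamP=> a.
by rewrite !(mxfamD, mxfamZ, mxfamE) mulmxDl scalemxAl.
Qed.
Fact rep_ract_linearr m : linear (rep_ract m).
Proof.
move=> k s t; apply/mxfamP=> a.
by rewrite !(mxfamD, mxfamZ, mxfamE) mulmxDr scalemxAr.
Qed.
Fact rep_lact1 m : rep_lact 1 m = m.
Proof. by apply/mxfamP=> a; rewrite !(mxalg1, mxfamE) mul1mx. Qed.
Fact rep_ract1 m : rep_ract m 1 = m.
Proof. by apply/mxfamP=> a; rewrite !(mxalg1, mxfamE) mulmx1. Qed.
Fact rep_lactA s t m : rep_lact (s * t) m = rep_lact s (rep_lact t m).
Proof. by apply/mxfamP=> a; rewrite !(mxalgM, mxfamE) mulmxA. Qed.
Fact rep_ractA m s t : rep_ract m (s * t) = rep_ract (rep_ract m s) t.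
Proof. by apply/mxfamP=> a; rewrite !(mxalgM, mxfamE) mulmxA. Qed.
Fact rep_lractA s m t :
  rep_ract (rep_lact s m) t = rep_lact s (rep_ract m t).
Proof. by apply/mxfamP=> a; rewrite !mxfamE mulmxA. Qed.
HB.instance Definition _ := Lmodule_isBimodule.Build K salg rep
  rep_lact_linearl rep_lact_linearr rep_ract_linearl rep_ract_linearr
  rep_lact1 rep_ract1 rep_lactA rep_ractA rep_lractA.

Definition salg_star (s : salg) : salg :=
  mxfam_mk (fun v =>
    castmx (dim_phi v, dim_phi v)
      (invmx (gamma (phi0 v)) *m (s (phi0 v))^T *m gamma (phi0 v))).

(* The inner cast rewrites tail (phi a) = phi (head a), head (phi a) = phi (tail a). *)
Definition rep_star (m : rep) : rep :=
  mxfam_mk (fun a =>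
    ((sig a)%:~R * (eps (tail a))%:~R) *:
    castmx (dim_phi (head a), dim_phi (tail a))
      (invmx (gamma (phi0 (head a)))
       *m castmx (congr1 (@dim K G) (tail_phi a),
                  congr1 (@dim K G) (head_phi a)) (m (phi1 a))^T
       *m gamma (phi0 (tail a)))).

Lemma eps_sq (v : vertex G) : (eps v)%:~R * (eps v)%:~R = 1 :> K.
Proof. by case: (eps_sign v) => ->; rewrite -intrM. Qed.

Lemma eps_phi0 (v : vertex G) : eps (phi0 v) = eps v.
Proof.
have := eps_phi v.
by case: (eps_sign v) => ->; case: (eps_sign (phi0 v)) => ->.
Qed.

Let gphi (v : vertex G) := castmx (dim_phi v, dim_phi v) (gamma (phi0 v)).

Let gphiE v : gphi v = (eps v)%:~R *: (gamma v)^T.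
Proof. by rewrite gamma_phi linearZ /= trmxK scalerA eps_sq scale1r. Qed.

Let gphi_unit v : gphi v \in unitmx.
Proof.
rewrite gphiE unitmxZ ?unitmx_tr ?gamma_unit //.
by apply/unitrP; exists (eps v)%:~R; rewrite eps_sq.
Qed.

Let invgphiE v : invmx (gphi v) = (eps v)%:~R *: (invmx (gamma v))^T.
Proof.
apply: (can_inj (mulKmx (gphi_unit v))).
rewrite mulmxV // gphiE -scalemxAl -scalemxAr scalerA eps_sq scale1r.
by rewrite -trmx_mul mulVmx ?gamma_unit // trmx1.
Qed.

Let sphi (s : salg) v := castmx (dim_phi v, dim_phi v) (s (phi0 v)).

Let salg_starE s v : salg_star s v = invmx (gphi v) *m (sphi s v)^T *m gphi v.
Proof.
by rewrite mxfamE !(castmx_mulmx _ (dim_phi v)) castmx_invmx trmx_cast.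
Qed.

Let dim_hphi (a : arrow G) : dim (head (phi1 a)) = dim (tail a).
Proof. by rewrite head_phi dim_phi. Qed.
Let dim_tphi (a : arrow G) : dim (tail (phi1 a)) = dim (head a).
Proof. by rewrite tail_phi dim_phi. Qed.

Let mphi (m : rep) a := castmx (dim_hphi a, dim_tphi a) (m (phi1 a)).

Let rep_starE m a : rep_star m a = ((sig a)%:~R * (eps (tail a))%:~R) *:
  (invmx (gphi (head a)) *m (mphi m a)^T *m gphi (tail a)).
Proof.
rewrite mxfamE (castmx_mulmx _ (dim_phi (tail a))).
rewrite (castmx_mulmx _ (dim_phi (head a))) castmx_invmx castmx_comp /=.
by rewrite trmx_cast /=; congr (_ *: (_ *m castmx _ _ *m _)); congr pair;
   apply: eq_irrelevance.
Qed.

Fact salg_star_linear : linear salg_star.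
Proof.
move=> k s t; apply/mxfamP=> v; rewrite mxfamD mxfamZ !salg_starE /sphi.
rewrite mxfamD mxfamZ castmx_linear linearP /= mulmxDr mulmxDl.
by rewrite -scalemxAr -scalemxAl.
Qed.

Fact rep_star_linear : linear rep_star.
Proof.
move=> k m l; apply/mxfamP=> a; rewrite mxfamD mxfamZ !rep_starE /mphi.
rewrite mxfamD mxfamZ castmx_linear linearP /= mulmxDr mulmxDl.
by rewrite -scalemxAr -scalemxAl scalerDr !scalerA [_ * k]mulrC.
Qed.

Fact salg_starM s t : salg_star (s * t) = salg_star t * salg_star s.
Proof.
apply/mxfamP=> v; rewrite mxalgM !salg_starE /sphi mxalgM.
rewrite (castmx_mulmx _ (dim_phi v)) trmx_mul !mulmxA.
by rewrite -[X in _ = X *m _ *m _]mulmxA mulmxV // mulmx1.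
Qed.

Fact salg_starK : involutive salg_star.
Proof.
move=> s; apply/mxfamP=> v; rewrite salg_starE {1}/sphi mxfamE castmx_comp /=.
rewrite !(castmx_mulmx _ (etrans (dim_phi (phi0 v)) (dim_phi v))).
rewrite castmx_invmx (castmx_fam (fun v => gamma v) _ (phi0K v)).
rewrite (castmx_fam (fun v => (s v)^T) _ (phi0K v)).
rewrite invgphiE gphiE -!scalemxAl -scalemxAr scalerA eps_sq scale1r.
rewrite -!trmx_mul !mulmxA mulmxV ?gamma_unit // mul1mx.
by rewrite -mulmxA mulmxV ?gamma_unit // mulmx1 trmxK.
Qed.

Fact rep_starK : involutive rep_star.
Proof.
move=> m; apply/mxfamP=> a; rewrite rep_starE {1}/mphi mxfamE castmxZ.
rewrite castmx_comp /=.
set eh := etrans _ (dim_hphi a); set et := etrans _ (dim_tphi a).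
have hh : phi0 (head (phi1 a)) = tail a by rewrite head_phi phi0K.
have tt : phi0 (tail (phi1 a)) = head a by rewrite tail_phi phi0K.
rewrite (castmx_mulmx _ et) (castmx_mulmx _ eh) castmx_invmx castmx_comp /=.
rewrite (castmx_fam (fun v => gamma v) _ hh).
rewrite (castmx_fam (fun v => gamma v) _ tt).
rewrite (castmx_fam (fun a => (m a)^T) _ (phi1K a)).
rewrite invgphiE gphiE tail_phi eps_phi0.
have trZ k p q (A : 'M[K]_(p, q)) : (k *: A)^T = k *: A^T by rewrite linearZ.
rewrite !trZ -!scalemxAl -!scalemxAr -!scalemxAl -?scalemxAr !scalerA.
rewrite -!trmx_mul !mulmxA mulmxV ?gamma_unit // mul1mx.
rewrite -mulmxA mulmxV ?gamma_unit // mulmx1 trmxK.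
have mulE x y z w : x * y * z * (y * (w * z)) = x * w * ((y * y) * (z * z)) :> K.
  by rewrite -!mulrA (mulrCA z y) (mulrCA z w) !(mulrCA y w).
by rewrite mulE !eps_sq !mulr1 -intrM sig_phi scale1r.
Qed.

Fact rep_star_act s m t :
  rep_star (ract (lact s m) t) =
  ract (lact (salg_star t) (rep_star m)) (salg_star s).
Proof.
have actE x y z : ract (lact (x : salg) (y : rep)) (z : salg) =
    mxfam_mk (fun a => x (head a) *m y a *m z (tail a)) :> rep.
  by apply/mxfamP=> a; rewrite !mxfamE.
rewrite !actE; apply/mxfamP=> a; rewrite [RHS]mxfamE !rep_starE !salg_starE.
rewrite {1}/mphi mxfamE (castmx_mulmx _ (dim_tphi a)).
rewrite (castmx_mulmx _ (dim_hphi a)) -/(mphi m a).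
have -> : castmx (dim_hphi a, dim_hphi a) (s (head (phi1 a))) = sphi s (tail a).
  rewrite /sphi; move: (dim_hphi a) (dim_phi (tail a)); rewrite head_phi.
  by move=> e e'; congr (castmx (_, _) _); apply: eq_irrelevance.
have -> : castmx (dim_tphi a, dim_tphi a) (t (tail (phi1 a))) = sphi t (head a).
  rewrite /sphi; move: (dim_tphi a) (dim_phi (head a)); rewrite tail_phi.
  by move=> e e'; congr (castmx (_, _) _); apply: eq_irrelevance.
rewrite -scalemxAr -scalemxAl; congr (_ *: _).
rewrite !trmx_mul !mulmxA -[X in _ = X *m _ *m _ *m _ *m _ *m _]mulmxA.
rewrite mulmxV // mulmx1 -[X in _ = X *m _ *m _]mulmxA.
by rewrite mulmxV // mulmx1.
Qed.

Definition setting_dual : dualizing rep :=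
  @Dualizing K salg rep salg_star rep_star salg_star_linear rep_star_linear salg_starK rep_starK
    salg_starM rep_star_act.
End SettingDual.

(* Main.v *)
Require Import Defs.
From HB Require Import structures.
From mathcomp Require Import all_boot all_order all_algebra.
From mathcomp Require Import complex reals boolp.

(** A semisimple algebra is von Neumann regular; over an algebraically closed
    field this splits 1 into orthogonal primitive idempotents [f] with
    [f S f = K f].  Picking one representative [e_v] in each isomorphism class
    yields matrix units: [u_(v,i)] in [S e_v] and [w_(v,i)] in [e_v S] with
    [w_(v,i) u_(v,j) = delta_ij e_v] and [sum u w = 1].

    The idempotent [e_v^*] is isomorphic to a unique [e_(phi v)], through
    [p_v q_v = e_(phi v)] and [q_v p_v = e_v^*], normalised so that
    [q_v^* = eps_v q_(phi v)].  The line spanned by [q_v] contains all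
    [u_(v,j)^* u_(phi v,k)], whose coordinates form [gamma_(phi v)].

    Arrows from [t] to [h] are a basis of [e_h M e_t].  The maps
    [x |-> eps_t p_h^* x^* q_t^*] from [e_(phi t) M e_(phi h)] to [e_h M e_t]
    are mutually inverse: on two swapped components take a basis and its image,
    on a component mapped to itself take a basis of eigenvectors.  The isomorphism is
    [F(m)_a = (c_a (w_(h,i) m u_(t,j)))_(i,j)] with [c_a] the coordinate of the
    arrow [a]; on [S] it is the same formula for [S] as a bimodule over itself,
    with one loop [e_v] at each vertex. *)

Set Implicit Arguments.
Unset Strict Implicit.
Unset Printing Implicit Defensive.

Import GRing.Theory Num.Theory.
Local Open Scope ring_scope.

(** * Linear algebra in finite dimension *)

Section FiniteDimensional.
Variable K : fieldType.
Implicit Types V : lmodType K.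

Definition linear_of (U V : lmodType K) (f : U -> V) (lin_f : linear f) :
    {linear U -> V} :=
  HB.pack f (GRing.isLinear.Build K U V *:%R f lin_f).

Lemma fd_coordinates V : finite_dimensional V ->
  exists n (r : {linear V -> 'rV[K]_n}) (s : {linear 'rV[K]_n -> V}),
    cancel r s /\ cancel s r.
Proof.
case=> n [[r lin_r [s rK sK]]]; exists n, (linear_of lin_r).
by exists (linear_of (can2_linear (f := linear_of lin_r) rK sK)).
Qed.

(** Rank factorization [P = C R] of the matrix of [p]: the rows of [R] form a basis of the image,
    the columns of [C] give the coordinate forms, and [P P = P] forces the duality [R C = 1]. *)
Lemma fd_projection_basis V (p : {linear V -> V}) :
  finite_dimensional V -> (forall x, p (p x) = p x) ->
  exists d (x : 'I_d -> V) (c : 'I_d -> {linear V -> K^o}),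
    [/\ forall i, p (x i) = x i, forall i m, c i (p m) = c i m,
        forall i j, c i (x j) = (i == j)%:R
      & forall m, p m = \sum_i c i m *: x i].
Proof.
move=> /fd_coordinates [n [r [s [rK sK]]]] pp.
pose P := lin1_mx (r \o p \o s).
have PE m : r (p m) = r m *m P by rewrite mul_rV_lin1 /= rK.
have [d [C [R [CR fullC freeR]]]] : exists d (C : 'M_(n, d)) (R : 'M_(d, n)),
    [/\ C *m R = P, row_full C & row_free R].
  exists (\rank P), (col_base P), (row_base P).
  by rewrite mulmx_base col_base_full row_base_free.
have PP : P *m P = P.
  by apply/row_matrixP=> i; rewrite !rowE mulmxA !mul_rV_lin1 /= rK pp.
have RC : R *m C = 1%:M.
  apply: (row_free_inj freeR); rewrite mul1mx -mulmxA CR.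
  have /row_fullP[L LC] := fullC.
  have -> : R = L *m P by rewrite -CR mulmxA LC mul1mx.
  by rewrite -mulmxA PP.
have lin_c i : linear (fun m => (r m *m C) 0 i : K^o).
  by move=> k m m'; rewrite linearP /= mulmxDl -scalemxAl !mxE.
exists d, (fun i => s (row i R)), (fun i => linear_of (lin_c i)).
split=> [i | i m | i j | m].
- by rewrite -[LHS]rK PE sK -row_mul -CR mulmxA RC mul1mx.
- by rewrite /= PE -CR -!mulmxA RC mulmx1.
- by rewrite /= sK -row_mul RC !mxE eq_sym.
- rewrite -[LHS]rK PE -CR mulmxA mulmx_sum_row linear_sum.
  by apply: eq_bigr => i _; rewrite linearZ.
Qed.
End FiniteDimensional.

(** As [T] maps into the image of [p], which is nonzero, its matrix [A] in a basis of that image has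
    an eigenvector over an algebraically closed field. *)
Lemma fd_projection_eigenvector (K : numClosedFieldType) (V : lmodType K)
    (p T : {linear V -> V}) : finite_dimensional V ->
  (forall x, p (p x) = p x) -> (forall x, p (T x) = T x) ->
  (exists x, p x != 0) -> exists2 x, x != 0 & p x = x /\ exists k, T x = k *: x.
Proof.
move=> fdV pp pT [x0 px0].
have [d [x [c [px cp cx pE]]]] := fd_projection_basis fdV pp.
have d_gt0 : (0 < d)%N.
  case: d x c px cp cx pE => // x c _ _ _ pE.
  by move: px0; rewrite pE big_ord0 eqxx.
pose A := \matrix_(i, j) c j (T (x i)).
(* Commuting matrices share an eigenvector; here both are [A]. *)
have [|v v0 /andP[/sub_rVP[k vA] _]] := @common_eigenvector2 K d A A d_gt0.
  by [].
pose y := \sum_i v 0 i *: x i.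
have cy i : c i y = v 0 i.
  rewrite linear_sum (bigD1 i) //= linearZ /= cx eqxx big1 ?addr0 => [|j ij].
    by rewrite /GRing.scale /= mulr1.
  by rewrite linearZ /= cx eq_sym (negPf ij) scaler0.
exists y.
  apply: contraNneq v0 => y0; apply/eqP/rowP=> i.
  by rewrite -cy y0 linear0 mxE.
split; first by rewrite linear_sum; apply: eq_bigr => i _; rewrite linearZ /= px.
exists k; rewrite -[LHS]pT pE scaler_sumr; apply: eq_bigr => j _.
rewrite scalerA; congr (_ *: _); have /rowP/(_ j) := vA; rewrite !mxE => <-.
rewrite !linear_sum; apply: eq_bigr => i _.
by rewrite !linearZ /= mxE.
Qed.

(** * Primitive idempotents *)

(** Split [1 = x a + z] along the left ideal [S a] and a complement. Then [a - a x a = a z] lies in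
    both, hence vanishes. *)
Lemma semisimple_regular (S : pzRingType) :
  semisimple S -> forall a : S, exists x, a * x * a = a.
Proof.
move=> ssS a; have [|J [[J0 JD JM] IJ0 IJ]] := ssS (fun y => exists x, y = x * a).
  split; first by exists 0; rewrite mul0r.
    by move=> _ _ [x ->] [y ->]; exists (x + y); rewrite mulrDl.
  by move=> b _ [x ->]; exists (b * x); rewrite mulrA.
have [_ [z [[x ->] Jz one]]] := IJ 1; exists x.
apply/eqP; rewrite eq_sym -subr_eq0 -[X in X - _]mulr1 one mulrDr mulrA addrC addKr.
apply/eqP/IJ0; last exact: JM.
exists (1 - a * x); rewrite mulrBl mul1r.
by apply/eqP; rewrite eq_sym subr_eq -mulrA -{1}[a]mulr1 {1}one mulrDr addrC.
Qed.

Section Algebra.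
Variables (K : numClosedFieldType) (S : pzAlgType K).
Implicit Types (a b e f g x y : S) (k : K).

Lemma pzscalerAl k x y : k *: x * y = k *: (x * y).
Proof. by rewrite -[RHS]/(algscale k (x * y)) algscaleAl. Qed.

Lemma pzscalerAr k x y : x * (k *: y) = k *: (x * y).
Proof. by rewrite -[RHS]/(algscale k (x * y)) algscaleAr. Qed.

Fact lmul_linear a : linear ( *%R a).
Proof. by move=> k x y; rewrite mulrDr pzscalerAr. Qed.
Definition lmul a : {linear S -> S} := linear_of (lmul_linear a).

(** Asking that [e S e] be the line [K e], rather than that [e] be indecomposable, gives each corner
    a scalar coordinate. *)
Definition primitive e : Prop :=
  [/\ e * e = e, e != 0 & forall x, exists k, e * x * e = k *: e].

Hypothesis regS : forall a, exists x, a * x * a = a.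

(** With [a x a = a], take [b = f x e]. Then [a b] and [b a] are nonzero idempotents on the lines
    [K e] and [K f], so they are [e] and [f]. *)
Lemma primitive_iso e f a : primitive e -> primitive f -> a != 0 ->
  e * a = a -> a * f = a ->
  exists b, [/\ f * b = b, b * e = b, a * b = e & b * a = f].
Proof.
have unit_scale (g : S) k : g * g = g -> (k *: g) * (k *: g) = k *: g -> k *: g != 0 ->
    k *: g = g.
  move=> gg; rewrite pzscalerAl pzscalerAr gg => /eqP; rewrite -subr_eq0 -scalerBr.
  have [-> | k0] := eqVneq k 0; first by rewrite !scale0r eqxx.
  by rewrite scaler_eq0 (negPf k0) subr_eq0 => /eqP.
move=> [ee _ eS] [ff _ fS] a0 ea af; have [x ax] := regS a.
have axa0 : a * x * a != 0 by rewrite ax.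
exists (f * x * e); rewrite !mulrA ff -!mulrA ee; split=> //; rewrite !mulrA.
  rewrite af; have [k kE] := eS (a * x); rewrite !mulrA ea in kE.
  rewrite kE; apply: unit_scale => //; rewrite -kE.
    by rewrite !mulrA -[_ * e * a]mulrA ea ax.
  by apply: contraNneq axa0 => axe; rewrite -{2}ea mulrA axe mul0r.
rewrite -[f * x * e * a]mulrA ea; have [k kE] := fS (x * a).
rewrite !mulrA -[_ * a * f]mulrA af in kE.
rewrite kE; apply: unit_scale => //; rewrite -kE.
  by rewrite !mulrA -[_ * a * f]mulrA af -!mulrA (mulrA a) ax.
by apply: contraNneq axa0 => fxa; rewrite -{1}af -!mulrA [f * _]mulrA fxa mulr0.
Qed.

Hypothesis finS : finite_dimensional S.

(** Left multiplication by a non-scalar [e x0 e] has an eigenvector [x] in [e S], of eigenvalue [k].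
    Then [b = e x0 e - k e] is nonzero and kills [x]; regularity [b y b = b] makes [f = e y b]
    idempotent, and [f x = 0] separates it from [e]. *)
Lemma split_idempotent e : e * e = e -> e != 0 -> ~ primitive e ->
  exists f, [/\ f * f = f, f != 0, f != e, e * f = f & f * e = f].
Proof.
move=> ee e0 not_prim.
have [x0 x0P] : exists x, forall k, e * x * e != k *: e.
  apply: contrapT => no_x; apply: not_prim; split=> // x; apply: contrapT => no_k.
  by apply: no_x; exists x => k; apply/eqP => kE; apply: no_k; exists k.
have [x /=|x /=||x x_n0 [/= ex [k ax]]] :=
  @fd_projection_eigenvector K S (lmul e) (lmul (e * x0 * e)) finS.
- by rewrite mulrA ee.
- by rewrite !mulrA ee.
- by exists 1; rewrite /= mulr1.
pose b := e * x0 * e - k *: e.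
have b0 : b != 0 by rewrite subr_eq0.
have bx : b * x = 0 by rewrite mulrBl ax pzscalerAl ex subrr.
have eb : e * b = b by rewrite mulrBr !mulrA pzscalerAr !ee.
have be : b * e = b by rewrite mulrBl -!mulrA pzscalerAl !ee mulrA.
have [y yP] := regS b.
exists (e * y * b); split.
- by rewrite -!mulrA (mulrA b e) be (mulrA b y) yP.
- apply: contraNneq b0 => f0.
  by rewrite -yP -{1}be -!mulrA (mulrA e) f0 mulr0.
- by apply: contraNneq x_n0 => fe; rewrite -ex -fe -mulrA bx mulr0.
- by rewrite !mulrA ee.
- by rewrite -mulrA be.
Qed.

(** Induction on the dimension of [e S], the rank of left multiplication by [e]: a nonzero [e] that
    is not primitive splits as [f + (e - f)], both of smaller rank. *)
Lemma primitive_decomposition e : e * e = e ->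
  exists (I : finType) (f : I -> S),
    [/\ forall i, primitive (f i), forall i, e * f i = f i /\ f i * e = f i,
        forall i j, i != j -> f i * f j = 0 & \sum_i f i = e].
Proof.
have [n [r [s [rK sK]]]] := fd_coordinates finS.
pose L a := lin1_mx (r \o lmul a \o s).
have LE a x : r x *m L a = r (a * x) by rewrite mul_rV_lin1 /= rK.
(* If the ranks agreed, [e'] would lie in [f S], so [f e' = e'], whereas [f e' = f]. *)
have rank_lt f e' : f * f = f -> e' * f = f -> f * e' = f -> f != e' ->
    (\rank (L f) < \rank (L e'))%N.
  move=> ff ef fe nfe; apply: rank_ltmx; rewrite ltmxE; apply/andP; split.
    apply/submxP; exists (L f); apply/row_matrixP=> i.
    by rewrite !rowE mulmxA -[delta_mx 0 i]sK !LE mulrA ef.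
  apply: contraNN nfe => /submxP[X LX]; rewrite -fe.
  have -> : e' = f * s (r 1 *m X).
    by apply: (can_inj rK); rewrite -LE sK -mulmxA -LX LE mulr1.
  by rewrite mulrA ff.
have [m] := ubnP (\rank (L e)); elim: m e => // m IHm e; rewrite ltnS => rank_e ee.
have [prim_e | not_prim] := pselect (primitive e).
  exists unit, (fun=> e); split=> [//|//|[] []//|].
  by rewrite (big_pred1 tt) // => -[].
have [-> | e0] := eqVneq e 0.
  by exists void, (fun=> 0); split=> [[]|[]|[]|]; rewrite big1 // => -[].
have [f [ff f0 nfe ef fe]] := split_idempotent ee e0 not_prim.
have [I1 [f1 [prim1 ef1 orth1 sum1]]] : exists (I : finType) (f1 : I -> S),
    [/\ forall i, primitive (f1 i), forall i, f * f1 i = f1 i /\ f1 i * f = f1 i,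
        forall i j, i != j -> f1 i * f1 j = 0 & \sum_i f1 i = f].
  by apply: IHm => //; apply: leq_trans rank_e; apply: rank_lt.
pose g := e - f.
have [gg eg ge fg gf] : [/\ g * g = g, e * g = g, g * e = g, f * g = 0 & g * f = 0].
  by rewrite !mulrBr !mulrBl ee ef fe ff !subrr subr0.
have [I2 [f2 [prim2 ef2 orth2 sum2]]] : exists (I : finType) (f1 : I -> S),
    [/\ forall i, primitive (f1 i), forall i, g * f1 i = f1 i /\ f1 i * g = f1 i,
        forall i j, i != j -> f1 i * f1 j = 0 & \sum_i f1 i = g].
  apply: IHm => //; apply: leq_trans rank_e; apply: rank_lt => //.
  by apply: contraNneq f0 => gE; rewrite -fe -gE fg.
exists (I1 + I2)%type, (fun i => match i with inl j => f1 j | inr j => f2 j end).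
split=> [[i|i]|[i|i]|[i|i] [j|j] ij|] //.
- by have [fi fi'] := ef1 i; split; [rewrite -fi mulrA ef | rewrite -fi' -mulrA fe].
- by have [fi fi'] := ef2 i; split; [rewrite -fi mulrA eg | rewrite -fi' -mulrA ge].
- exact: orth1.
- by rewrite -(proj2 (ef1 i)) -(proj1 (ef2 j)) -mulrA (mulrA f) fg mul0r mulr0.
- by rewrite -(proj2 (ef2 i)) -(proj1 (ef1 j)) -mulrA (mulrA g) gf mul0r mulr0.
- exact: orth2.
- by rewrite big_sumType /= sum1 sum2 addrC subrK.
Qed.
End Algebra.

(** * Matrix units *)

(** The usual matrix units of the class [v] are the products [u_i w_j]; their factors are kept
    because they bring elements into corners, where coordinates are scalars. *)
Record matrix_units (K : numClosedFieldType) (S : pzAlgType K) := MatrixUnits {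
  mu_class : finType;
  mu_dim : mu_class -> nat;
  mu_e : mu_class -> S;
  mu_u : forall v, 'I_(mu_dim v) -> S;
  mu_w : forall v, 'I_(mu_dim v) -> S;
  mu_primitive : forall v, primitive (mu_e v);
  mu_orth : forall v v' x, v != v' -> mu_e v * x * mu_e v' = 0;
  mu_ue : forall v i, mu_u (v := v) i * mu_e v = mu_u i;
  mu_ew : forall v i, mu_e v * mu_w (v := v) i = mu_w i;
  mu_wu : forall v i j, mu_w (v := v) i * mu_u j = (i == j)%:R *: mu_e v;
  mu_sum : \sum_v \sum_i mu_u (v := v) i * mu_w i = 1
}.

Arguments mu_e {K S} _ _.
Arguments mu_u {K S} _ _ _.
Arguments mu_w {K S} _ _ _.
Arguments mu_ue {K S} _ _ _.
Arguments mu_ew {K S} _ _ _.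
Arguments mu_wu {K S} _ _ _ _.

Section Existence.
Variables (K : numClosedFieldType) (S : pzAlgType K).
Hypothesis regS : forall a : S, exists x, a * x * a = a.
Hypothesis finS : finite_dimensional S.

(** Primitive idempotents are isomorphic as soon as some element links them, so being linked is an
    equivalence. [u] and [w] are mutually inverse isomorphisms between an idempotent and the
    representative of its class. *)
Lemma matrix_units_exist : inhabited (matrix_units S).
Proof.
have [I [f [prim _ orth sum1]]] := primitive_decomposition regS finS (mulr1 1).
have ff i : f i * f i = f i by case: (prim i).
have f0 i : f i != 0 by case: (prim i).
pose linked i j := `[< exists x, f i * x * f j != 0 >].
have linkedP i j : linked i j -> exists a b,
    [/\ f i * a = a, a * f j = a, f j * b = b & b * f i = b] /\
    a * b = f i /\ b * a = f j.
  move=> /asboolP[x x0].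
  have [| |b [fb bf ab ba]] := primitive_iso regS (prim i) (prim j) x0.
  - by rewrite !mulrA ff.
  - by rewrite -mulrA ff.
  by exists (f i * x * f j), b; split=> //; split=> //; rewrite ?mulrA ?ff // -mulrA ff.
have linked0 i : linked i i by apply/asboolP; exists 1; rewrite mulr1 ff.
have linkedC i j : linked i j -> linked j i.
  move=> /linkedP[a [b [[_ _ fb bf] [ab _]]]]; apply/asboolP; exists b.
  by rewrite fb bf; apply: contraNneq (f0 i) => b0; rewrite -ab b0 mulr0.
have linkedT i j k : linked i j -> linked j k -> linked i k.
  move=> /linkedP[a [b [[fa _ _ _] [_ ba]]]] /linkedP[a' [b' [[fa' a'f _ _] [ab' _]]]].
  apply/asboolP; exists (a * a'); rewrite mulrA fa -mulrA a'f.
  apply: contraNneq (f0 j) => aa'0.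
  by rewrite -ab' -fa' -ba -!mulrA (mulrA a) aa'0 mul0r mulr0.
(* [choose] depends only on the predicate up to extensionality, hence only on the class of [i]. *)
pose r i := choose (linked i) i.
have linked_r i : linked i (r i) by apply: chooseP.
have r_eq i j : linked i j -> r i = r j.
  move=> ij; rewrite /r (choose_id (linked0 i) ij); apply: eq_choose => k.
  by apply/idP/idP => [/(linkedT _ _ _ (linkedC _ _ ij)) | /(linkedT _ _ _ ij)].
have rr i : r (r i) == r i by rewrite -(r_eq _ _ (linked_r i)).
pose V := {v | r v == v}; pose rV i : V := exist _ (r i) (rr i).
have [u0 u0P] := choice (fun i => linkedP _ _ (linked_r i)).
have [w0 uwP] := choice u0P.
pose n (v : V) := #|[pred i | rV i == v]|.
have r_val (v : V) (k : 'I_(n v)) : r (enum_val k) = val v.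
  by have := enum_valP k; rewrite inE => /eqP /(congr1 val).
constructor; exists V n (fun v => f (val v)) (fun v k => u0 (enum_val k))
  (fun v k => w0 (enum_val k)) => [v|v v' x vv'|v k|v k|v k l|].
- exact: prim.
- apply/eqP; apply: contraNT vv' => x0; rewrite -val_eqE.
  rewrite -(eqP (valP v)) -(eqP (valP v')); apply/eqP/r_eq.
  by apply/asboolP; exists x.
- by have [[_ + _ _] _] := uwP (enum_val k); rewrite r_val.
- by have [[_ _ + _] _] := uwP (enum_val k); rewrite r_val.
- have [[_ _ _ wf] [_ wu]] := uwP (enum_val k).
  have [[fu _ _ _] _] := uwP (enum_val l).
  have [<- | kl] := eqVneq k l; first by rewrite wu r_val scale1r.
  rewrite -wf -fu -!mulrA (mulrA (f _)) orth ?mul0r ?mulr0 ?scale0r //.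
  by rewrite (inj_eq enum_val_inj).
- rewrite -sum1 (partition_big rV predT) //=; apply: eq_bigr => v _.
  rewrite -(big_enum_val (fun i => u0 i * w0 i)).
  by apply: eq_bigr => i _; have [_ [-> _]] := uwP i.
Qed.
End Existence.

(** * Pairing the classes through an involution *)

Section Involution.
Variables (K : numClosedFieldType) (S : pzAlgType K) (W : matrix_units S).
Hypothesis regS : forall a : S, exists x, a * x * a = a.
Variable star : {linear S -> S}.
Hypothesis starK : involutive star.
Hypothesis starM : forall a b, star (a * b) = star b * star a.

Local Notation V := (mu_class W).
Local Notation e := (mu_e W).

(** An isomorphism between the idempotents [star (e v)] and [e v'], given by inverse elements of the
    two mixed corners. *)
Definition pairing (v v' : V) (p q : S) :=
  [/\ e v' * p = p, p * star (e v) = p, star (e v) * q = q & q * e v' = q] /\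
  p * q = e v' /\ q * p = star (e v).

Let ee v : e v * e v = e v. Proof. by case: (mu_primitive v). Qed.
Let e0 v : e v != 0. Proof. by case: (mu_primitive v). Qed.

Lemma star_primitive v : primitive (star (e v)).
Proof.
have [_ _ ve] := mu_primitive v; split; first by rewrite -starM ee.
  by rewrite -(linear0 star) (inj_eq (inv_inj starK)).
move=> x; have [k kE] := ve (star x); exists k.
by rewrite -(starK x) -!starM mulrA kE linearZ.
Qed.

(** If no [e v'] were linked to [star (e v)], multiplying the latter by [1 = sum u w] would give
    0. *)
Lemma pairing_exist v : exists v' p q, pairing v v' p q.
Proof.
have [v' [x x0]] : exists v' x, e v' * x * star (e v) != 0.
  apply: contrapT => no; have [_ /eqP se0 _] := star_primitive v; apply: se0.
  rewrite -[LHS]mul1r -(mu_sum W) mulr_suml big1 // => v' _.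
  rewrite mulr_suml big1 // => i _; rewrite -mu_ew -mulrA.
  rewrite (_ : _ * star _ = 0) ?mulr0 //; apply: contrapT => /eqP ?.
  by apply: no; exists v'; exists (mu_w W v' i).
have [see _ _] := star_primitive v.
have [| |q] := primitive_iso regS (mu_primitive v') (star_primitive v) x0.
- by rewrite !mulrA ee.
- by rewrite -mulrA see.
move=> [sq qe pq qp]; exists v', (e v' * x * star (e v)), q.
by split=> //; split=> //; rewrite ?mulrA ?ee // -mulrA see.
Qed.

(** [star (e v) = q p] factors through [e v'], which only [e v'] itself can reach. *)
Lemma pairing_unique v v' v1 x p q :
  pairing v v' p q -> e v1 * x * star (e v) != 0 -> v1 = v'.
Proof.
move=> [[ep _ _ qe] [_ <-]]; apply: contraNeq => v1v'.
by rewrite -qe !mulrA -(mulrA _ x) mu_orth // mul0r.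
Qed.

Lemma pairing_star v v' p q : pairing v v' p q -> pairing v' v (star p) (star q).
Proof.
move=> [[ep pe eq qe] [pq qp]]; do 2!split; rewrite -?starM ?starK.
- by rewrite -[X in X * _]starK -starM pe.
- by rewrite ep.
- by rewrite qe.
- by rewrite -[X in _ * X]starK -starM eq.
- by rewrite qp starK.
- by rewrite pq.
Qed.

Lemma pairing_neq0 v v' p q : pairing v v' p q -> p != 0 /\ q != 0.
Proof.
move=> [_ [pq _]]; split.
  by apply: contraNneq (e0 v') => p0; rewrite -pq p0 mul0r.
by apply: contraNneq (e0 v') => q0; rewrite -pq q0 mulr0.
Qed.

Lemma pairing_sym v v' v1 p q p1 q1 :
  pairing v v' p q -> pairing v' v1 p1 q1 -> v1 = v.
Proof.
move=> /pairing_star pq pq1; apply/esym; apply: (pairing_unique pq1 (x := star p)).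
by have [[-> -> _ _] _] := pq; have [] := pairing_neq0 pq.
Qed.

(** The corner from [e v] to [star (e v)] is the line [K q], and [star] preserves it; the scalar by
    which it acts squares to 1. *)
Lemma pairing_sign v p q : pairing v v p q ->
  exists2 s : int, s = 1 \/ s = -1 & star q = s%:~R *: q.
Proof.
move=> pq; have [[ep pe eq qe] [pq1 qp1]] := pq.
have [[_ _ sq' sq] _] := pairing_star pq.
have [_ _ /(_ (p * star q))[k kE]] := mu_primitive v.
have sqE : star q = k *: q.
  have psq : p * star q = k *: e v by rewrite -kE mulrA ep -mulrA sq.
  by rewrite -sq' -qp1 -mulrA psq pzscalerAr qe.
have [_ q0] := pairing_neq0 pq.
have : k * k == 1.
  rewrite -subr_eq0; have : (k * k - 1) *: q == 0.
    by rewrite scalerBl scale1r -scalerA -sqE -[k *: _]linearZ -sqE starK subrr.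
  by rewrite scaler_eq0 (negPf q0) orbF.
rewrite -expr2 sqrf_eq1 => /orP[] /eqP kE1; [exists 1 | exists (-1)]; auto.
  by rewrite sqE kE1.
by rewrite sqE kE1 rmorphN.
Qed.

Lemma star_pairings : exists (phi : V -> V) (eps : V -> int) (p q : V -> S),
  [/\ involutive phi, forall v, eps v = 1 \/ eps v = -1,
      forall v, eps (phi v) = eps v & forall v, pairing v (phi v) (p v) (q v)] /\
  ((forall v, star (p v) = (eps v)%:~R *: p (phi v)) /\
   (forall v, star (q v) = (eps v)%:~R *: q (phi v))).
Proof.
have [phi phiP] := choice pairing_exist.
have [p0 p0P] := choice phiP; have [q0 pq0] := choice p0P.
have phiK : involutive phi by move=> v; apply: pairing_sym (pq0 v) (pq0 (phi v)).
have epsP v : exists s : int, [/\ s = 1 \/ s = -1,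
    phi v = v -> star (q0 v) = s%:~R *: q0 v & phi v <> v -> s = 1].
  have [vv | vv] := eqVneq (phi v) v; last first.
    by exists 1; split; auto => /eqP; rewrite (negPf vv).
  have := pq0 v; rewrite vv => /pairing_sign[s s1 sE].
  by exists s; split.
have [eps epsE] := choice epsP.
(* In each orbit of [phi] the lower vertex keeps its chosen pair and the other receives the starred
   one, so the sign is 1 on swapped vertices. *)
pose low v := (enum_rank v <= enum_rank (phi v))%N.
pose p v := if low v then p0 v else star (p0 (phi v)).
pose q v := if low v then q0 v else star (q0 (phi v)).
have pqP v : pairing v (phi v) (p v) (q v).
  rewrite /p /q; case: ifP => _; first exact: pq0.
  by have := pairing_star (pq0 (phi v)); rewrite phiK.
have eps_phi v : eps (phi v) = eps v.
  have [-> // | vv] := eqVneq (phi v) v.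
  have [_ _ ->] := epsE v; last exact/eqP.
  by have [_ _ -> //] := epsE (phi v); rewrite phiK; apply/eqP; rewrite eq_sym.
have star_q v : star (q v) = (eps v)%:~R *: q (phi v).
  rewrite /q /low phiK; have [vv | vv] := eqVneq (phi v) v.
    by rewrite vv leqnn; have [_ -> //] := epsE v.
  have [_ _ ->] := epsE v; last exact/eqP.
  rewrite scale1r; case: ltngtP => //.
  by move=> /val_inj/enum_rank_inj v_phi; rewrite -v_phi eqxx in vv.
exists phi, eps, p, q; split; first by split=> // v; have [] := epsE v.
split=> // v.
have [[_ _ _ _] [pq' _]] := pqP (phi v); rewrite phiK in pq'.
have [[pe _ _ _] [_ qp]] := pairing_star (pqP v).
(* Uniqueness of inverses: [star (p v)] is inverse to [star (q v)], which is a sign times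
   [q (phi v)]. *)
rewrite -[LHS]pe -[X in X * _]pq' -mulrA.
have epsK x : x = (eps v)%:~R *: ((eps v)%:~R *: x).
  rewrite scalerA -intrM; have [[->|->] _ _] := epsE v; by rewrite scale1r.
rewrite [q (phi v)]epsK -star_q pzscalerAl qp pzscalerAr.
by have [[_ -> _ _] _] := pqP (phi v).
Qed.
End Involution.

(** * Bases adapted to a graded involution *)

(* A signed dual basis carries the eigenvalue [sdb_s] of each basis vector under
   an involution; it is 1 where no involution acts. *)
Record signed_dual_basis (K : fieldType) (N : lmodType K) := SignedDualBasis {
  sdb_index : finType;
  sdb_x : sdb_index -> N;
  sdb_c : sdb_index -> {linear N -> K^o};
  sdb_s : sdb_index -> int
}.

Arguments sdb_x {K N} _ _.
Arguments sdb_c {K N} _ _.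
Arguments sdb_s {K N} _ _.

(** The forms are coordinates on the image of [p]; the vectors are pinned down only through their
    coordinates and may lie outside that image. *)
Definition splits (K : fieldType) (N : lmodType K) (p : N -> N)
    (B : signed_dual_basis N) :=
  [/\ forall i, sdb_s B i = 1 \/ sdb_s B i = -1,
      forall i m, sdb_c B i (p m) = sdb_c B i m,
      forall i j, sdb_c B i (sdb_x B j) = (i == j)%:R
    & forall m, (forall i, sdb_c B i m = 0) -> p m = 0].

Section Involution.
Variables (K : numFieldType) (N : lmodType K).
Hypothesis finN : finite_dimensional N.

Lemma projection_splits (p : {linear N -> N}) : (forall m, p (p m) = p m) ->
  exists B : signed_dual_basis N, splits p B /\ forall i, sdb_s B i = 1.
Proof.
move=> pp; have [d [x [c [_ cp cx pE]]]] := fd_projection_basis finN pp.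
exists (SignedDualBasis x c (fun=> 1)); split=> //; split=> //; first by left.
by move=> m c0; rewrite pE big1 // => i _; rewrite [c i m]c0 scale0r.
Qed.

(** On the image of [p] the map [t] is an involution, with eigenprojections [(p + t)/2] and
    [(p - t)/2]; bases of their images are put together. *)
Lemma involution_splits (p t : {linear N -> N}) : (forall m, p (p m) = p m) ->
  (forall m, p (t m) = t m) -> (forall m, t (p m) = t m) ->
  (forall m, t (t m) = p m) ->
  exists B : signed_dual_basis N,
    splits p B /\ forall i m, sdb_c B i (t m) = (sdb_s B i)%:~R * sdb_c B i m.
Proof.
move=> pp pt tp tt.
have lin_half k : linear (fun m => 2^-1 *: (p m + k *: t m)).
  move=> a m m'; rewrite (linearP p) (linearP t) /= (scalerDr k) (scalerA k).
  rewrite (mulrC k) -(scalerA a) addrACA.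
  by rewrite -(scalerDr a) (scalerDr 2^-1) (scalerA 2^-1) (mulrC 2^-1) -scalerA.
pose h k := linear_of (lin_half k).
have hp k m : h k (p m) = h k m by rewrite /= pp tp.
have ht k m : k * k = 1 -> h k (t m) = k *: h k m.
  move=> kk; rewrite /= pt tt scalerA mulrC -scalerA (scalerDr k) scalerA kk.
  by rewrite scale1r addrC.
(* For signs [k] and [l] the scalar is 1 if they agree and 0 otherwise: idempotency and
   orthogonality at once. *)
have hh k l m : k * k = 1 -> h k (h l m) = (2^-1 * (1 + l * k)) *: h k m.
  move=> kk; rewrite [h l m]/= linearZ_LR linearD [h k (_ *: _)]linearZ_LR hp ht //.
  by rewrite scalerA -{1}[h k m]scale1r -scalerDl scalerA.
have n11 : -1 * -1 = 1 :> K by rewrite mulrNN mulr1.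
have two : 2^-1 * 2 = 1 :> K by rewrite mulVf // pnatr_eq0.
have [|Bp [[_ cp xp zp] _]] := @projection_splits (h 1).
  by move=> m; rewrite hh ?mulr1 // two scale1r.
have [|Bm [[_ cm xm zm] _]] := @projection_splits (h (-1)).
  by move=> m; rewrite hh // n11 two scale1r.
pose x i := match i with inl j => h 1 (sdb_x Bp j) | inr j => h (-1) (sdb_x Bm j) end.
pose c i := match i with inl j => sdb_c Bp j | inr j => sdb_c Bm j end.
pose s (i : sdb_index Bp + sdb_index Bm) : int :=
  match i with inl j => 1 | inr j => -1 end.
exists (SignedDualBasis x c s); split; first split=> /=.
- by case=> i; [left | right].
- by case=> i m /=; rewrite -1?cp -1?cm hp ?cp ?cm.
- case=> i [] j /=; first by rewrite cp xp.
  + by rewrite -cp hh ?mulr1 // subrr mulr0 scale0r linear0.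
  + by rewrite -cm hh // mul1r subrr mulr0 scale0r linear0.
  + by rewrite cm xm.
- move=> m c0; have -> : p m = h 1 m + h (-1) m.
    by rewrite /= -scalerDr addrACA scale1r scaleN1r subrr addr0 -mulr2n -scaler_nat
      scalerA two scale1r.
  by rewrite zp ?zm ?addr0 // => i; [apply: (c0 (inr i)) | apply: (c0 (inl i))].
- case=> i m /=.
    by rewrite -cp ht ?mulr1 // scale1r cp mul1r.
  by rewrite -cm ht // linearZ /= cm.
Qed.

Section Graded.
Variables (P : finType) (psi : P -> P) (p t : P -> {linear N -> N}).
Hypothesis psiK : involutive psi.
Hypothesis pp : forall i m, p i (p i m) = p i m.
Hypothesis pt : forall i m, p i (t i m) = t i m.
Hypothesis tp : forall i m, t i (p (psi i) m) = t i m.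
Hypothesis tt : forall i m, t i (t (psi i) m) = p i m.

(** [p i] projects onto the component of degree [i], and [t i] carries degree [psi i] to degree [i].
    A fixed degree gets an eigenbasis; of two swapped degrees one gets a basis and the other its
    transport. *)
Lemma graded_involution_basis :
  exists (A : finType) (deg : A -> P) (alpha : A -> A) (s : A -> int)
    (x : A -> N) (c : A -> {linear N -> K^o}),
    [/\ involutive alpha, forall a, deg (alpha a) = psi (deg a),
        forall a, deg (alpha a) = deg a -> alpha a = a,
        forall a, s a = 1 \/ s a = -1 & forall a, s (alpha a) = s a] /\
    [/\ forall a m, c a (p (deg a) m) = c a m,
        forall a b, deg a = deg b -> c a (x b) = (a == b)%:R,
        forall i m, (forall a, deg a = i -> c a m = 0) -> p i m = 0
      & forall a m, c a (t (deg a) m) = (s a)%:~R * c (alpha a) m].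
Proof.
have basis i : exists B : signed_dual_basis N,
    [/\ splits (p i) B,
        psi i = i -> forall j m, sdb_c B j (t i m) = (sdb_s B j)%:~R * sdb_c B j m
      & psi i <> i -> forall j, sdb_s B j = 1].
  have [ii | ii] := eqVneq (psi i) i.
    have [||||B [BP Bs]] := @involution_splits (p i) (t i); first exact: pp.
    - exact: pt.
    - by move=> m; have := tp i m; rewrite ii.
    - by move=> m; have := tt i m; rewrite ii.
    by exists B.
  have [|B [BP Bs]] := @projection_splits (p i); first exact: pp.
  by exists B; split=> // /eqP; rewrite (negPf ii).
have [B BP] := choice basis.
pose low i := (enum_rank i <= enum_rank (psi i))%N.
(* [((i, j), true)] is the [j]-th basis vector in degree [i] and [((i, j), false)]
   its image under [t] in degree [psi i]; keeping one degree [i] from each orbit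
   of [psi] avoids identifying the index types of [i] and [psi i]. *)
pose cond (z : {i : P & sdb_index (B i)} * bool) :=
  low (tag z.1) && ((psi (tag z.1) == tag z.1) ==> z.2).
have lowN i : ~~ low i -> low (psi i) /\ psi i <> i.
  rewrite /low psiK -ltnNge => lt; split; first exact: ltnW.
  by move=> ii; rewrite ii ltnn in lt.
have low_psi i : low i -> psi i <> i -> ~~ low (psi i).
  rewrite /low psiK => le /eqP ii; rewrite -ltnNge ltn_neqAle le andbT.
  by rewrite (inj_eq val_inj) (inj_eq enum_rank_inj) eq_sym.
pose flip (z : {i : P & sdb_index (B i)} * bool) :=
  (z.1, if psi (tag z.1) == tag z.1 then z.2 else ~~ z.2).
have cond_flip z : cond z -> cond (flip z).
  by rewrite /cond /=; case: (low _) => //=; case: ifP.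
pose A := {z | cond z}.
pose alpha (a : A) : A := exist _ (flip (val a)) (cond_flip _ (valP a)).
pose deg (a : A) := let: (z, b) := val a in if b then tag z else psi (tag z).
pose s (a : A) := sdb_s (B _) (tagged (val a).1).
pose x (a : A) := let: (z, b) := val a in
  if b then sdb_x (B _) (tagged z) else t (psi (tag z)) (sdb_x (B _) (tagged z)).
(* A transported coordinate in degree [psi i] first moves its argument to degree [i] by [t i]. *)
pose c (a : A) : {linear N -> K^o} := let: (z, b) := val a in
  if b then sdb_c (B _) (tagged z) else sdb_c (B _) (tagged z) \o t (tag z).
exists A, deg, alpha, s, x, c; split; split.
- move=> a; apply: val_inj; rewrite /= /flip /=; case: (val a) => z b /=.
  by case: (psi _ == _); rewrite ?negbK.
- case=> [[z b] /= zb]; rewrite /deg /= /flip /=.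
  by case: eqP => [zz | _]; case: b {zb} => //=; rewrite ?zz ?psiK ?zz.
- case=> [[z b] zb]; have [zz _ | zz] := eqVneq (psi (tag z)) (tag z).
    by apply: val_inj; rewrite /= /flip /= zz eqxx.
  move=> dd; exfalso; move: dd; rewrite /deg /= /flip /= (negPf zz).
  by move/eqP; case: b {zb} => /=; rewrite ?(negPf zz) // eq_sym (negPf zz).
- by move=> a; have [[+ _ _ _] _ _] := BP (tag (val a).1); apply.
- by [].
- case=> [[[i j] b] ib] m; rewrite /deg /c /=; have [[_ cp _ _] _ _] := BP i.
  by case: b {ib} => //=; rewrite -[in LHS]tp pp tp.
- case=> [[[i j] b] ib] [[[i' j'] b'] ib']; rewrite /deg /c /x /= => dd.
  have off k l : cond (existT _ k l, false) -> ~~ low (psi k).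
    by rewrite /cond /= implybF => /andP[low_k /eqP]; apply: low_psi.
  have on k l e : cond (existT _ k l, e) -> low k by case/andP.
  (* A swapped orbit has one low degree, so the degree of a basis vector determines its flag. *)
  have [ii' bb'] : i = i' /\ b = b'.
    case: b b' ib ib' dd => [] [] ib ib' //= dd;
      [| |by split=> //; apply: (can_inj psiK)].
    - by have := off _ _ ib'; rewrite -dd (on _ _ _ ib).
    - by have := off _ _ ib; rewrite dd (on _ _ _ ib').
  subst i' b'.
  have -> :
    (exist _ (existT _ i j, b) ib == exist _ (existT _ i j', b) ib' :> A) = (j == j').
    by rewrite -val_eqE /= xpair_eqE eqxx andbT eq_Tagged.
  have [[_ cp cx _] _ _] := BP i.
  by case: b {ib ib' dd} => //=; rewrite tt cp cx.
- move=> i m c0; have [low_i | /lowN[low_i ii]] := boolP (low i).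
    have [[_ _ _ +] _ _] := BP i; apply=> j.
    have ci : cond (existT _ i j, true) by rewrite /cond /= low_i implybT.
    exact: (c0 (exist (fun z => cond z) _ ci) erefl).
  have [[_ _ _ sep] _ _] := BP (psi i).
  rewrite -tt -[t (psi i) m]pt sep ?linear0 // => j.
  have ci : cond (existT _ (psi i) j, false).
    by rewrite /cond /= low_i psiK implybF eq_sym; apply/eqP.
  by have := c0 (exist (fun z => cond z) _ ci); rewrite /c /= /deg /= psiK; apply.
- case=> [[[i j] b] ib] m; rewrite /deg /c /s /=.
  have [[_ cp _ _] cs s1] := BP i; rewrite /flip /=.
  case: eqP => ii; case: b ib => //= ib.
  + exact: cs.
  + by move: ib; rewrite /cond /= ii eqxx andbF.
  + by rewrite s1 // mul1r.
  + by rewrite s1 // mul1r tt cp.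
Qed.
End Graded.
End Involution.

(** * Coordinates *)

Section Sandwich.
Variables (K : fieldType) (S : pzAlgType K) (N : bimodType S).
Implicit Types (a b : S) (m : N).

Fact sandwich_linear a b : linear (fun m : N => ract (lact a m) b).
Proof. by move=> k m m'; rewrite lact_linearr ract_linearl. Qed.
Definition sandwich a b : {linear N -> N} := linear_of (sandwich_linear a b).

Fact sandwich_linearl b m : linear (fun a => sandwich a b m).
Proof. by move=> k a a'; rewrite /= lact_linearl ract_linearl. Qed.
Fact sandwich_linearr a m : linear (fun b => sandwich a b m).
Proof. by move=> k b b'; rewrite /= ract_linearr. Qed.

Lemma sandwichZl k a b m : sandwich (k *: a) b m = k *: sandwich a b m.
Proof. exact: (linearZ_LR (linear_of (sandwich_linearl b m))). Qed.
Lemma sandwichZr k a b m : sandwich a (k *: b) m = k *: sandwich a b m.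
Proof. exact: (linearZ_LR (linear_of (sandwich_linearr a m))). Qed.
Lemma sandwich_suml (I : Type) (r : seq I) (P : pred I) (f : I -> S) b m :
  sandwich (\sum_(i <- r | P i) f i) b m = \sum_(i <- r | P i) sandwich (f i) b m.
Proof. exact: (linear_sum (linear_of (sandwich_linearl b m))). Qed.
Lemma sandwich_sumr (I : Type) (r : seq I) (P : pred I) (f : I -> S) a m :
  sandwich a (\sum_(i <- r | P i) f i) m = \sum_(i <- r | P i) sandwich a (f i) m.
Proof. exact: (linear_sum (linear_of (sandwich_linearr a m))). Qed.
Lemma sandwich0l b m : sandwich 0 b m = 0.
Proof. exact: (linear0 (linear_of (sandwich_linearl b m))). Qed.
Lemma sandwich0r a m : sandwich a 0 m = 0.
Proof. exact: (linear0 (linear_of (sandwich_linearr a m))). Qed.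
Lemma sandwich_sandwich a b a' b' m :
  sandwich a b (sandwich a' b' m) = sandwich (a * a') (b' * b) m.
Proof. by rewrite /= lactA ractA !lractA. Qed.
Lemma sandwich11 m : sandwich 1 1 m = m.
Proof. by rewrite /= lact1 ract1. Qed.
End Sandwich.

Section RegularBimodule.
Variables (K : pzRingType) (S : pzAlgType K).
Implicit Types a m : S.
Fact reg_mul_linearl m : linear (fun a => a * m).
Proof.
by move=> k a b; rewrite mulrDl -[k *: a]/(algscale k a) -algscaleAl.
Qed.
Fact reg_mul_linearr a : linear (fun m => a * m).
Proof.
by move=> k m n; rewrite mulrDr -[k *: m]/(algscale k m) -algscaleAr.
Qed.
(** An alias of [S] as bimodule over itself, so that the results on [coords] also apply to the
    algebra. *)
Definition regular_bimod : Type := S.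
HB.instance Definition _ := GRing.Lmodule.on regular_bimod.
HB.instance Definition _ := Lmodule_isBimodule.Build K S regular_bimod
  reg_mul_linearl reg_mul_linearr reg_mul_linearl reg_mul_linearr
  (@mul1r S) (@mulr1 S) (fun a b m => esym (mulrA a b m)) (@mulrA S)
  (fun a m b => esym (mulrA a m b)).
End RegularBimodule.

(** * Blocks and one-dimensional corners *)

Section Blocks.
Variables (K : numClosedFieldType) (S : pzAlgType K) (W : matrix_units S).
Local Notation V := (mu_class W).
Local Notation e := (mu_e W).
Local Notation n := (@mu_dim _ _ W).
Local Notation u := (mu_u W).
Local Notation w := (mu_w W).

(** The central idempotent of the class [v]. *)
Definition block v := \sum_i u v i * w v i.

Lemma block_sum : \sum_v block v = 1. Proof. exact: mu_sum. Qed.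

Lemma mu_ee v : e v * e v = e v. Proof. by case: (mu_primitive v). Qed.

Lemma block_only_r v a : (forall v' x, v' != v -> a * x * e v' = 0) ->
  forall x, a * x * block v = a * x.
Proof.
move=> av x; rewrite -[RHS]mulr1 -block_sum (bigD1 v) //= mulrDr.
rewrite [X in _ + X]mulr_sumr [X in _ = _ + X]big1 ?addr0 // => v' v'v.
rewrite mulr_sumr big1 // => i _.
by rewrite -mu_ue !mulrA -(mulrA a) av // mul0r.
Qed.

Lemma block_only_l v a : (forall v' x, v' != v -> e v' * x * a = 0) ->
  forall x, block v * x * a = x * a.
Proof.
move=> av x; rewrite -[RHS]mul1r -block_sum (bigD1 v) //= mulrDl -mulrA.
rewrite [X in _ + X]mulr_suml [X in _ = _ + X]big1 ?addr0 // => v' v'v.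
rewrite mulr_suml big1 // => i _.
by rewrite -mu_ew -!mulrA (mulrA (w _ _)) (mulrA (e _)) av // mulr0.
Qed.

Lemma block_e v x : block v * x * e v = x * e v.
Proof. by apply: block_only_l => v' y ?; apply: mu_orth. Qed.

Lemma e_block v x : e v * x * block v = e v * x.
Proof. by apply: block_only_r => v' y ?; apply: mu_orth; rewrite eq_sym. Qed.

Lemma mu_wu0 v v' i j : v != v' -> w v i * u v' j = 0.
Proof. by move=> vv'; rewrite -mu_ew -mu_ue -mulrA [w _ _ * _]mulrA mulrA mu_orth. Qed.

Lemma mu_e_inj v (k l : K) : k *: e v = l *: e v -> k = l.
Proof.
have [_ e0 _] := mu_primitive v; move=> /eqP; rewrite -subr_eq0 -scalerBl.
by rewrite scaler_eq0 (negPf e0) orbF subr_eq0 => /eqP.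
Qed.

Fact corner_coord_exists v : exists k : S -> K, forall x, e v * x * e v = k x *: e v.
Proof. by have [_ _ /choice[k kE]] := mu_primitive v; exists k. Qed.
Definition corner_fun v : S -> K := projT1 (cid (corner_coord_exists v)).
Lemma corner_funE v x : e v * x * e v = corner_fun v x *: e v.
Proof. exact: projT2 (cid (corner_coord_exists v)) x. Qed.
Fact corner_linear v : linear (corner_fun v : regular_bimod S -> K^o).
Proof.
move=> k x y; apply: (@mu_e_inj v); rewrite -corner_funE mulrDr mulrDl scalerDl.
by rewrite pzscalerAr pzscalerAl !corner_funE scalerA.
Qed.
Definition corner v : {linear regular_bimod S -> K^o} := linear_of (corner_linear v).
Lemma cornerE v x : e v * x * e v = corner v x *: e v.
Proof. exact: corner_funE. Qed.
Lemma corner_e v : corner v (e v : regular_bimod S) = 1.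
Proof. by apply: (@mu_e_inj v); rewrite -cornerE !mu_ee scale1r. Qed.
End Blocks.

Section Matrices.
Variables (K : numClosedFieldType) (S : pzAlgType K) (W : matrix_units S).
Local Notation V := (mu_class W).
Local Notation e := (mu_e W).
Local Notation n := (@mu_dim _ _ W).
Local Notation u := (mu_u W).
Local Notation w := (mu_w W).

Definition matrix_of (s : S) : mxalg K n :=
  mxfam_mk (fun v => \matrix_(i, j) corner v (w v i * s * u v j)).

(** Insert [block v] to the right of [s]; each [w_i s u_k] is a multiple of [e v]. *)
Lemma w_mul v i s : w v i * s = \sum_k matrix_of s v i k *: w v k.
Proof.
rewrite -mu_ew -mulrA -e_block mulr_sumr; apply: eq_bigr => k _.
rewrite mxfamE mxE -[in RHS](mu_ew W v k) -pzscalerAl -cornerE.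
by rewrite !mulrA -(mulrA _ (e v) (w v k)) (mu_ew _ _ k).
Qed.

Lemma mul_u v j s : s * u v j = \sum_k matrix_of s v k j *: u v k.
Proof.
rewrite -mu_ue mulrA -block_e !mulr_suml; apply: eq_bigr => k _.
rewrite mxfamE mxE -[in RHS](mu_ue W v k) -pzscalerAr -cornerE.
by rewrite !mulrA (mu_ue _ _ k).
Qed.

Lemma matrix_of_monoid_morphism : monoid_morphism matrix_of.
Proof.
split=> [|s s']; apply/mxfamP=> v; apply/matrixP=> i j; rewrite mxfamE mxE.
  by rewrite mulr1 mu_wu linearZ_LR corner_e mxalg1 mxE /GRing.scale /= mulr1.
rewrite mulrA w_mul !mulr_suml linear_sum mxalgM mxE; apply: eq_bigr => k _.
by rewrite !pzscalerAl linearZ_LR [matrix_of s' v]mxfamE [in RHS]mxE.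
Qed.

Lemma mu_u_cast v v' (E : n v = n v') i : v = v' -> u v (cast_ord (esym E) i) = u v' i.
Proof. by move=> vv'; subst v'; congr u; apply: val_inj. Qed.
Lemma mu_w_cast v v' (E : n v = n v') i : v = v' -> w v (cast_ord (esym E) i) = w v' i.
Proof. by move=> vv'; subst v'; congr w; apply: val_inj. Qed.

(** The sizes at [v] and [phi v] are only provably equal; this turns the rectangular identity
    relating [cogram] and [gram] into invertibility of a square matrix. *)
Lemma mulmx1_castmx m k (E : m = k) (B : 'M[K]_(k, m)) (C : 'M_m) :
  B *m castmx (erefl m, E) C = 1%:M ->
  C \in unitmx /\ castmx (E, erefl m) (invmx C) = B.
Proof.
case: k / E B => B; rewrite !castmx_id => BC.
have [_ C_unit] := mulmx1_unit BC; split=> //.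
by rewrite -[LHS]mul1mx -BC mulmxK.
Qed.

(** * The involution of the algebra through Gram matrices *)

Section StarAlgebra.
Variable star : {linear S -> S}.
Hypothesis starK : involutive star.
Hypothesis starM : forall a b, star (a * b) = star b * star a.

(** Gram matrix of the bilinear form [star x * y] in the bases [u]; its values lie on the line
    [K q], and multiplying by [p] brings them into the corner of [v']. *)
Definition gram v v' (p : S) : 'M[K]_(n v', n v) :=
  \matrix_(k, j) corner v' (p * star (u v j) * u v' k).
Definition cogram v v' (q : S) : 'M[K]_(n v, n v') :=
  \matrix_(i, l) corner v' (w v' l * star (w v i) * q).

Section Pairing.
Variables (v v' : V) (p q : S).
Hypothesis pq : pairing star v v' p q.

Lemma star_u_mul j k : star (u v j) * u v' k = gram v v' p k j *: q.
Proof.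
have [[ep pe eq qe] [_ qp]] := pq.
have su : star (u v j) = star (e v) * star (u v j) by rewrite -starM mu_ue.
rewrite mxE -qe -pzscalerAr -cornerE !mulrA qe -mulrA mu_ue.
by rewrite {1}su -qp.
Qed.

Lemma star_u j : star (u v j) = \sum_k gram v v' p k j *: (q * w v' k).
Proof.
have [[ep pe eq qe] [_ qp]] := pq.
have -> : star (u v j) = star (e v) * star (u v j) * block v'.
  rewrite block_only_r => [|v1 x v1v']; first by rewrite -starM mu_ue.
  by rewrite -qp -qe -!mulrA (mulrA p) (mulrA (e v')) mu_orth ?mulr0 // eq_sym.
rewrite mulr_sumr; apply: eq_bigr => k _.
by rewrite -starM mu_ue mulrA star_u_mul pzscalerAl.
Qed.

Lemma star_w i : star (w v i) = \sum_l cogram v v' q i l *: (u v' l * p).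
Proof.
have [[ep pe eq qe] [_ qp]] := pq.
have -> : star (w v i) = block v' * star (w v i) * star (e v).
  rewrite block_only_l => [|v1 x v1v']; first by rewrite -starM mu_ew.
  by rewrite -qp -ep !mulrA -(mulrA _ x) mu_orth ?mul0r.
rewrite !mulr_suml; apply: eq_bigr => l _.
rewrite mxE -pzscalerAr -ep -pzscalerAl -cornerE.
by rewrite !mulrA mu_ue -(mulrA _ (e v') p) ep -(mulrA _ q p) qp.
Qed.

(** Apply [star] to [w_i u_j = delta_ij e_v] and compare coefficients of [star (e v)]. *)
Lemma cogram_gram : cogram v v' q *m gram v v' p = 1%:M.
Proof.
have [[ep pe eq qe] [pq1 qp]] := pq.
apply/matrixP=> i j; apply: (@mu_e_inj _ _ W v); apply: (inv_inj starK).
have <- : w v i * u v j = (1%:M : 'M[K]_(n v)) i j *: e v by rewrite mu_wu mxE.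
rewrite linearZ_LR starM star_w mulr_sumr mxE scaler_suml; apply: eq_bigr => l _.
by rewrite pzscalerAr mulrA star_u_mul pzscalerAl qp scalerA.
Qed.
End Pairing.

Lemma pairing_dim v v' p q : pairing star v v' p q -> n v' = n v.
Proof.
move=> pq; apply/eqP; rewrite eqn_leq.
have le v1 v2 p1 q1 : pairing star v1 v2 p1 q1 -> (n v1 <= n v2)%N.
  by move/cogram_gram/mulmx1_min.
by rewrite (le _ _ _ _ pq) (le _ _ _ _ (pairing_star starK starM pq)).
Qed.
End StarAlgebra.

(** * Matrix coordinates of a bimodule *)

Section Coordinates.
Variables (N : bimodType S) (A : finType) (h t : A -> V).
Variables (x : A -> N) (c : A -> {linear N -> K^o}).
Hypothesis c_corner : forall a m, c a (sandwich N (e (h a)) (e (t a)) m) = c a m.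
Hypothesis c_x : forall a b, h a = h b -> t a = t b -> c a (x b) = (a == b)%:R.
Hypothesis c_separates : forall v v' m,
  (forall a, h a = v -> t a = v' -> c a m = 0) -> sandwich N (e v) (e v') m = 0.

Definition coords (m : N) : mxfam K (fun a => n (h a)) (fun a => n (t a)) :=
  mxfam_mk (fun a =>
    \matrix_(i, j) c a (sandwich N (w (h a) i) (u (t a) j) m)).

Lemma coordsE m a i j :
  coords m a i j = c a (sandwich N (w (h a) i) (u (t a) j) m).
Proof. by rewrite mxfamE mxE. Qed.

Lemma coords_linear : linear coords.
Proof.
move=> k m m'; apply/mxfamP => a; apply/matrixP=> i j.
by rewrite mxfamD mxfamZ !mxE !coordsE !linearP.
Qed.

(** By separation, equal coordinates make every [w d u] vanish for the difference [d], and [d] is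
    recovered by inserting [1 = sum u w] on both sides. *)
Lemma coords_inj : injective coords.
Proof.
move=> m m' mm'; apply/eqP; rewrite -subr_eq0; apply/eqP.
have /mxfamP : coords (m - m') = 0.
  have := coords_linear (-1) m' m; rewrite !scaleN1r [- m' + _]addrC => ->.
  by rewrite mm' addNr.
set d := m - m' => d0.
have wdu v v' i j : sandwich N (w v i) (u v' j) d = 0.
  rewrite -(mu_ew W v i) -(mu_ue W v' j) -sandwich_sandwich.
  apply: c_separates => a ha ta; subst v v'.
  by have /matrixP/(_ i j) := d0 a; rewrite coordsE /= => ->; rewrite mxfamE mxE.
rewrite -[d]sandwich11 -{1}(mu_sum W) sandwich_suml big1 // => v _.
rewrite sandwich_suml big1 // => i _.
rewrite -(mu_sum W) sandwich_sumr big1 // => v' _.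
rewrite sandwich_sumr big1 // => j _.
by rewrite -sandwich_sandwich wdu linear0.
Qed.

Lemma mu_wu_scale v v' i j : exists k : K, w v i * u v' j = k *: e v.
Proof.
have [vv' | vv'] := eqVneq v v'; last by exists 0; rewrite mu_wu0 // scale0r.
by subst v'; exists (i == j)%:R; rewrite mu_wu.
Qed.

Lemma coords_surj y : exists m, coords m = y.
Proof.
exists (\sum_a \sum_i \sum_j
  y a i j *: sandwich N (u (h a) i) (w (t a) j) (x a)).
apply/mxfamP=> b; apply/matrixP=> k l; rewrite coordsE.
pose T a i j := c b (sandwich N (w (h b) k * u (h a) i) (w (t a) j * u (t b) l) (x a)).
have -> : c b (sandwich N (w (h b) k) (u (t b) l) (\sum_a \sum_i \sum_j
    y a i j *: sandwich N (u (h a) i) (w (t a) j) (x a))) =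
    \sum_a \sum_i \sum_j y a i j * T a i j.
  rewrite !linear_sum; apply: eq_bigr => a _; rewrite !linear_sum.
  apply: eq_bigr => i _; rewrite !linear_sum; apply: eq_bigr => j _.
  by rewrite !linearZ_LR sandwich_sandwich.
(* Only the term at [(b, k, l)] survives. *)
rewrite (bigD1 b) //= (bigD1 k) //= (bigD1 l) //=.
rewrite [X in _ + X + _ + _]big1 ?[X in _ + _ + X + _]big1 ?[X in _ + _ + _ + X]big1.
- by rewrite /T !mu_wu !eqxx !scale1r c_corner c_x // eqxx mulr1 !addr0.
- move=> a ab; rewrite big1 // => i _; rewrite big1 // => j _.
  rewrite /T; have [hh | hh] := eqVneq (h b) (h a); last first.
    by rewrite mu_wu0 // sandwich0l linear0 mulr0.
  have [tt | tt] := eqVneq (t b) (t a); last first.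
    by rewrite [X in sandwich _ _ X]mu_wu0 1?eq_sym // sandwich0r linear0 mulr0.
  have [z ->] := mu_wu_scale k i.
  have [z' ->] := mu_wu_scale j l.
  rewrite (congr1 e (esym tt)) sandwichZl sandwichZr 2!(linearZ_LR (c b)).
  rewrite c_corner c_x //.
  by rewrite eq_sym (negPf ab) !scaler0 mulr0.
- move=> i ik; rewrite big1 // => j _.
  by rewrite /T mu_wu eq_sym (negPf ik) scale0r sandwich0l linear0 mulr0.
- move=> j jl.
  by rewrite /T [X in sandwich _ _ X]mu_wu (negPf jl) scale0r sandwich0r linear0 mulr0.
Qed.

Lemma coords_bij : bijective coords.
Proof.
have [g gK] := choice coords_surj.
by exists g => // m; apply: coords_inj; rewrite gK.
Qed.

Lemma coords_act s m s' a :
  coords (sandwich N s s' m) a =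
  matrix_of s (h a) *m coords m a *m matrix_of s' (t a).
Proof.
apply/matrixP=> i j; rewrite coordsE sandwich_sandwich w_mul mul_u sandwich_sumr.
rewrite linear_sum mxE; apply: eq_bigr => l _.
rewrite sandwichZr linearZ_LR sandwich_suml linear_sum mxE [RHS]mulrC.
congr (_ * _); apply: eq_bigr => k _.
by rewrite sandwichZl linearZ_LR coordsE.
Qed.

Section Star.
Variables (star : {linear S -> S}) (starN : {linear N -> N}).
Hypothesis starK : involutive star.
Hypothesis starM : forall a b, star (a * b) = star b * star a.
Hypothesis starNE : forall a b m,
  starN (sandwich N a b m) = sandwich N (star b) (star a) (starN m).
Variables (phi : V -> V) (p q : V -> S).
Hypothesis pq : forall v, pairing star v (phi v) (p v) (q v).
Variables (alpha : A -> A) (s : A -> K).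
Hypothesis h_alpha : forall a, h (alpha a) = phi (t a).
Hypothesis t_alpha : forall a, t (alpha a) = phi (h a).
Hypothesis c_star : forall a m,
  c a (sandwich N (star (p (h a))) (star (q (t a))) (starN m)) = s a * c (alpha a) m.

Lemma coords_star m a (Et : n (t (alpha a)) = n (phi (h a)))
    (Eh : n (h (alpha a)) = n (phi (t a))) :
  coords (starN m) a = s a *:
    (cogram star (h a) (phi (h a)) (q (h a))
     *m castmx (Et, Eh) (coords m (alpha a))^T
     *m gram star (t a) (phi (t a)) (p (t a))).
Proof.
(* [w_i] and [u_j] move inside [starN], where their stars expand along the opposite units through
   [gram] and [cogram]. *)
apply/matrixP=> i j; rewrite coordsE -{1}(starK (w _ i)) -{1}(starK (u _ j)) -starNE.
rewrite (star_u starM (pq _)) (star_w starM (pq _)) sandwich_suml linear_sum linear_sum.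
move: (gram _ _ _ _) (cogram _ _ _ _) => G H.
rewrite !mxE mulr_sumr; apply: eq_bigr => k _.
rewrite sandwich_sumr !linear_sum mxE mulr_suml mulr_sumr; apply: eq_bigr => l _.
rewrite sandwichZl sandwichZr -sandwich_sandwich.
rewrite 2!(linearZ_LR starN) 2!(linearZ_LR (c a)) starNE c_star.
rewrite castmxE mxE coordsE mu_w_cast // mu_u_cast //.
rewrite /GRing.scale /=.
by rewrite [LHS]mulrC !mulrA (mulrC (H i l)).
Qed.
End Star.
End Coordinates.
End Matrices.

(** * The setting *)

Section Setting.
Variables (K : numClosedFieldType) (S : pzAlgType K) (W : matrix_units S).
Local Notation V := (mu_class W).
Local Notation n := (@mu_dim _ _ W).
Local Notation u := (mu_u W).
Variable star : {linear S -> S}.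
Hypothesis starK : involutive star.
Hypothesis starM : forall a b, star (a * b) = star b * star a.
Variables (phi : V -> V) (eps : V -> int) (p q : V -> S).
Hypothesis phiK : involutive phi.
Hypothesis pq : forall v, pairing star v (phi v) (p v) (q v).
Hypothesis star_q : forall v, star (q v) = (eps v)%:~R *: q (phi v).

Lemma dim_phiE v : n (phi v) = n v.
Proof. exact: (pairing_dim starK starM (pq v)). Qed.

(** The matrix [gamma_v]: the [(k, j)] entry is the coordinate of [star (u (phi v) j) * u v k], with
    the columns cast to [n v]. *)
Definition form v : 'M[K]_(n v) :=
  castmx (erefl (n v), dim_phiE v) (gram star (phi v) v (p (phi v))).

Lemma form_phi v :
  castmx (erefl, dim_phiE v) (form (phi v)) = gram star v (phi v) (p v).
Proof.
rewrite /form castmx_comp /=; move: (etrans _ _); rewrite phiK => E.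
by rewrite (eq_irrelevance E erefl) castmx_id.
Qed.

Lemma form_cogram v : form (phi v) \in unitmx /\
  castmx (dim_phiE v, erefl) (invmx (form (phi v))) = cogram star v (phi v) (q v).
Proof.
by apply: mulmx1_castmx; rewrite form_phi; apply: (cogram_gram starK starM (pq v)).
Qed.

Lemma form_unit v : form v \in unitmx.
Proof. by have [+ _] := form_cogram (phi v); rewrite phiK. Qed.

(** [star] exchanges the products [star (u (phi v) j) * u v k] and [star (u v k) * u (phi v) j], and
    it sends [q v] to [eps v] times [q (phi v)]. *)
Lemma gram_phi v k j :
  gram star (phi v) v (p (phi v)) k j = (eps v)%:~R * gram star v (phi v) (p v) j k.
Proof.
have pq' : pairing star (phi v) v (p (phi v)) (q (phi v)).
  by have := pq (phi v); rewrite phiK.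
have := star_u_mul starM pq' j k.
rewrite -(starK (u v k)) -starM (star_u_mul starM (pq v)) linearZ_LR star_q scalerA.
move=> /eqP; rewrite -subr_eq0 -scalerBl scaler_eq0 subr_eq0.
by have [_ /negPf->] := pairing_neq0 pq'; rewrite orbF mulrC => /eqP.
Qed.

Lemma form_sym v :
  form v = (eps v)%:~R *: (castmx (dim_phiE v, dim_phiE v) (form (phi v)))^T.
Proof.
have -> : castmx (dim_phiE v, dim_phiE v) (form (phi v)) =
    castmx (dim_phiE v, erefl) (gram star v (phi v) (p v)).
  by rewrite -form_phi castmx_comp; congr (castmx (_, _)); apply: eq_irrelevance.
by apply/matrixP=> k j; rewrite castmxE gram_phi !mxE castmxE cast_ord_id mxE.
Qed.

Lemma form_conj v v' (Y : 'M_(n (phi v), n (phi v'))) :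
  castmx (dim_phiE v, dim_phiE v') (invmx (form (phi v)) *m Y *m form (phi v')) =
  cogram star v (phi v) (q v) *m Y *m gram star v' (phi v') (p v').
Proof.
rewrite (castmx_mulmx _ erefl) (castmx_mulmx _ erefl) castmx_id form_phi.
by have [_ ->] := form_cogram v.
Qed.
End Setting.

(** * Assembling the quiver setting and the isomorphism *)

Lemma dualizing_iso_setting (K : numClosedFieldType) (S : pzAlgType K)
    (M : bimodType S) (D : dualizing M) :
  finite_dimensional S -> semisimple S -> finite_dimensional M ->
  exists G : setting K, dualizing_iso D (setting_dual G).
Proof.
move=> finS /semisimple_regular regS finM.
have [W] := matrix_units_exist regS finS.
pose star := linear_of (starS_linear D); pose starN := linear_of (starM_linear D).
have starK : involutive star := starSK D.
have starNK : involutive starN := starMK D.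
have starM a b : star (a * b) = star b * star a := starS_mul D a b.
have starNE a b m : starN (sandwich M a b m) = sandwich M (star b) (star a) (starN m).
  exact: starM_act.
have [phi [eps [p [q [[phiK eps1 eps_phi pq] [star_p star_q]]]]]] :=
  star_pairings W regS starK starM.
pose V := mu_class W; pose e := mu_e W.
pose psi (ht : V * V) := (phi ht.2, phi ht.1).
pose pi (ht : V * V) := sandwich M (e ht.1) (e ht.2).
(* Unsigned, two successive maps would compose to [eps h * eps t] times the projection; the factor
   [eps t] cancels this sign and is the one in the formula for the dual of a representation. *)
pose tau (ht : V * V) : {linear M -> M} :=
  sandwich M ((eps ht.2)%:~R *: star (p ht.1)) (star (q ht.2)) \o starN.
have ee v : e v * e v = e v := mu_ee v.
have eps2 v : (eps v)%:~R * (eps v)%:~R = 1 :> K.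
  by case: (eps1 v) => ->; rewrite -intrM.
have [|||||A [deg [alpha [s [x [c [[alphaK deg_alpha alpha_fix s1 s_alpha]
  [c_pi c_x c_sep c_tau]]]]]]]] := @graded_involution_basis K M finM _ psi pi tau.
- by case=> h t; rewrite /psi /= !phiK.
- by case=> h t m; rewrite [LHS]sandwich_sandwich !ee.
- case=> h t m; have [[sp ps qs sq] _] := pairing_star starK starM (pq h).
  have [[sp' _ _ sq'] _] := pairing_star starK starM (pq t).
  by rewrite [LHS]sandwich_sandwich pzscalerAr sp sq'.
- case=> h t m; have [[sp ps qs sq] _] := pairing_star starK starM (pq h).
  have [[sp' ps' qs' sq'] _] := pairing_star starK starM (pq t).
  rewrite -[LHS]/(sandwich M ((eps t)%:~R *: star (p h)) (star (q t))
    (starN (sandwich M (e (phi t)) (e (phi h)) m))) starNE sandwich_sandwich.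
  by rewrite pzscalerAl ps qs'.
- case=> h t m.
  have pqh := pq (phi h); have pqt := pq (phi t); rewrite !phiK in pqh pqt.
  rewrite -[LHS]/(sandwich M ((eps t)%:~R *: star (p h)) (star (q t)) (starN
    (sandwich M ((eps (phi h))%:~R *: star (p (phi t))) (star (q (phi h))) (starN m)))).
  rewrite starNE sandwich_sandwich linearZ_LR !starK starNK star_p star_q eps_phi.
  rewrite !pzscalerAl !pzscalerAr (proj1 (proj2 pqh)) (proj1 (proj2 pqt)).
  rewrite !sandwichZl !sandwichZr !scalerA -(mulrA (eps t)%:~R) eps2 mulr1 eps2.
  by rewrite scale1r.
pose dphi := dim_phiE starK starM pq.
pose Q := @SupermixedQuiver (@Quiver V A (fun a => (deg a).1) (fun a => (deg a).2))
  phi alpha eps s phiK alphaK eps1 s1.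
have head_phi a : (deg (alpha a)).1 = phi (deg a).2 by rewrite deg_alpha.
(* Equal heads give [h = phi t], so [psi] fixes the degree of [a] and [alpha] fixes [a]. *)
have head_phi_fix a : (deg a).1 = (deg (alpha a)).1 -> a = alpha a.
  rewrite head_phi => ha; apply/esym/alpha_fix; rewrite deg_alpha /psi ha phiK -ha.
  by case: (deg a).
have eps_phiM v : eps v * eps (phi v) = 1.
  by rewrite eps_phi; case: (eps1 v) => ->.
have s_alphaM a : s a * s (alpha a) = 1.
  by rewrite s_alpha; case: (s1 a) => ->.
pose G := @Setting K (Q head_phi head_phi_fix eps_phiM s_alphaM) (@mu_dim _ _ W)
  (form starK starM pq) (form_unit starK starM phiK pq) dphi
  (form_sym starK starM phiK pq star_q).
exists G.
pose h a := (deg a).1; pose t a := (deg a).2.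
have c_corner a m : c a (sandwich M (mu_e W (h a)) (mu_e W (t a)) m) = c a m.
  exact: c_pi.
have c_x' a b : h a = h b -> t a = t b -> c a (x b) = (a == b)%:R.
  move=> hh tt; apply: c_x; move: hh tt; rewrite /h /t.
  by case: (deg a) (deg b) => [? ?] [? ?] /= -> ->.
have c_sep' v v' m : (forall a, h a = v -> t a = v' -> c a m = 0) ->
    sandwich M (mu_e W v) (mu_e W v') m = 0.
  by move=> hm; apply: (c_sep (v, v')) => a aE; apply: hm; rewrite /h /t aE.
(* The algebra is treated as a bimodule whose arrows are one loop per vertex, with coordinate
   [corner v] and basis vector [e v]. *)
pose N := regular_bimod S.
have k_corner v (m : N) : corner v (sandwich N (mu_e W v) (mu_e W v) m) = corner v m.
  by rewrite [sandwich _ _ _ _]cornerE linearZ_LR corner_e /GRing.scale /= mulr1.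
have k_x v v' : v = v' -> v = v' -> corner v (mu_e W v' : N) = (v == v')%:R.
  by move=> <- _; rewrite corner_e eqxx.
have k_sep v v' (m : N) : (forall a : V, a = v -> a = v' -> corner a m = 0) ->
    sandwich N (mu_e W v) (mu_e W v') m = 0.
  have [<- | vv'] := eqVneq v v'; last by move=> _; apply: mu_orth.
  by move=> /(_ v erefl erefl) k0; rewrite [LHS]cornerE k0 scale0r.
exists (matrix_of W), (coords h t c); split.
- split.
  + exact: (@coords_linear _ _ W N V id id (@corner _ _ W)).
  + exact: matrix_of_monoid_morphism.
  + exact: (@coords_bij _ _ W N V id id (mu_e W) (@corner _ _ W) k_corner k_x k_sep).
- split; first exact: coords_linear.
  exact: (coords_bij c_corner c_x' c_sep').
- move=> a m b; apply/mxfamP => i; rewrite [LHS]coords_act.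
  by rewrite !mxfamE.
- move=> m; apply/mxfamP=> v.
  (* The sandwich is the star of [q m p], a multiple of [q p = star (e v0)], so the loops carry the
     scalar 1. *)
  have k_star v0 (m0 : N) : corner v0 (sandwich N (star (p v0)) (star (q v0)) (star m0))
      = 1 * corner (phi v0) m0.
    have -> : sandwich N (star (p v0)) (star (q v0)) (star m0) =
        corner (phi v0) m0 *: mu_e W v0.
      have [[ep _ _ qe] [_ qp]] := pq v0.
      rewrite -[LHS]/(star (p v0) * star m0 * star (q v0)) -!starM -{1}qe -ep.
      rewrite !mulrA -(mulrA (q v0)) -(mulrA (q v0)) cornerE pzscalerAr pzscalerAl.
      by rewrite qe qp linearZ_LR starK.
    by rewrite linearZ_LR corner_e /GRing.scale /= mulr1 mul1r.
  rewrite -[LHS]/(coords (N := regular_bimod S) id id (@corner _ _ W) (star m) v).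
  rewrite (@coords_star _ _ W N V id id (@corner _ _ W) star star starK starM _
    phi p q pq phi (fun=> 1) _ _ k_star m v erefl erefl) //.
    rewrite scale1r castmx_id [RHS]mxfamE.
    by rewrite [RHS](form_conj starK starM phiK pq).
  by move=> a b m0; rewrite -[LHS]/(star (a * m0 * b)) !starM mulrA.
- move=> m; apply/mxfamP=> a.
  (* The sign inside [tau] crosses the equation because it squares to 1. *)
  have c_star a0 m0 : c a0 (sandwich M (star (p (h a0))) (star (q (t a0))) (starN m0))
      = ((s a0)%:~R * (eps (t a0))%:~R) * c (alpha a0) m0.
    rewrite [(s a0)%:~R * _]mulrC -mulrA -c_tau.
    have -> : tau (deg a0) m0 = (eps (t a0))%:~R *:
        sandwich M (star (p (h a0))) (star (q (t a0))) (starN m0).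
      exact: sandwichZl.
    by rewrite linearZ_LR /GRing.scale /= mulrA eps2 mul1r.
  rewrite -[LHS]/(coords h t c (starN m) a).
  have t_alpha a0 : t (alpha a0) = phi (h a0) by rewrite /t deg_alpha.
  have Et : mu_dim (t (alpha a)) = mu_dim (phi (h a)) :=
    congr1 (@mu_dim _ _ W) (t_alpha a).
  have Eh : mu_dim (h (alpha a)) = mu_dim (phi (t a)) :=
    congr1 (@mu_dim _ _ W) (head_phi a).
  rewrite (coords_star starK starM starNE pq head_phi t_alpha c_star m Et Eh).
  rewrite [RHS]mxfamE; congr (_ *: _).
  rewrite [RHS](form_conj starK starM phiK pq).
  by congr (_ *m castmx (_, _) _ *m _); apply: eq_irrelevance.
Qed.

Theorem theorem3p1 (R : realType) (S : pzAlgType R[i]) (M : bimodType S)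
    (finS : finite_dimensional S) (ssS : semisimple S)
    (finM : finite_dimensional M) (D : dualizing M) :
  exists G : setting R[i], dualizing_iso D (setting_dual G).
Proof. exact: (@dualizing_iso_setting R[i] S M D). Qed.
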